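(* Let $\mathcal{H}$ be a finite-dimensional complex Hilbert space. Then $$\overline{\mathfrak{C}_{\mathfrak{E}}} = \mathrm{Bal}(\mathcal{H}),$$ where $\overline{\mathfrak{C}_{\mathfrak{E}}}$ denotes the norm-closure in $\mathcal{B}(\mathcal{H})$ of the set of commutators of idempotents.
   Context: $\mathcal{B}(\mathcal{H})$ is the algebra of bounded linear operators on $\mathcal{H}$ with the operator norm. $\mathfrak{E} := \{E \in \mathcal{B}(\mathcal{H}) : E^2 = E\}$ and $\mathfrak{C}_{\mathfrak{E}} := \{EF - FE : E, F \in \mathfrak{E}\}$. Balanced operators: for $T \in \mathcal{B}(\mathcal{H})$ and an open set $\Omega \subseteq \mathbb{C}$ such that $\sigma(T)\cap\Omega$ is relatively closed and open in $\sigma(T)$, $\mathcal{H}(\Omega;T)$ denotes the range of the Riesz idempotent of $T$ corresponding to $\sigma(T)\cap\Omega$. $T - \alpha I$ is semi-Fredholm if its range is closed and $\min(\dim\ker(T-\alpha I), \dim\ker(T-\alpha I)^* ) < \infty$, in which case $\mathrm{Ind}(T-\alpha I) := \dim\ker(T-\alpha I) - \dim\ker(T-\alpha I)^*$. The operator $T$ is called balanced if: (i) $\sigma(T) = \sigma(-T)$; (ii) whenever $\Omega_1,\Omega_2\subseteq\mathbb{C}$ are disjoint open sets with $\sigma(T)\subseteq\Omega_1\cup\Omega_2$, one has $\dim\mathcal{H}(\Omega_1;T) = \dim\mathcal{H}(-\Omega_1;T)$; (iii) for $\alpha\in\mathbb{C}$, $T-\alpha I$ is semi-Fredholm if and only if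 $T+\alpha I$ is semi-Fredholm, in which case $\mathrm{Ind}(T-\alpha I) = \mathrm{Ind}(T+\alpha I)$. $\mathrm{Bal}(\mathcal{H})$ denotes the set of balanced operators in $\mathcal{B}(\mathcal{H})$. *)

(* Defs.v *)
From HB Require Import structures.
From mathcomp Require Import all_boot all_order all_algebra.
From mathcomp Require Import complex.
From mathcomp Require Import all_classical all_reals all_analysis.

Set Implicit Arguments.
Unset Strict Implicit.
Unset Printing Implicit Defensive.

Import Order.TTheory GRing.Theory Num.Theory.
Import numFieldNormedType.Exports.

Local Open Scope classical_set_scope.
Local Open Scope ring_scope.
Local Open Scope complex_scope.

(* A finite-dimensional complex Hilbert space is a vectType over R[i] together
   with a positive definite form [dot], linear in its first argument and
   conjugate-linear in the second; completeness is automatic.  Every linear map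
   being bounded, B(H) is 'End(H). *)

Section Norm.
Context (R : realType) (H : vectType R[i]) (dot : {dot H for Num.conj}).
Implicit Types (T : 'End(H)) (x : H).

Definition hilbert_norm x : R := Num.sqrt (complex.Re (dot x x)).

Definition opnorm T : R :=
  sup [set hilbert_norm (T x) | x in [set x | hilbert_norm x <= 1]].

Definition norm_closure (A : set 'End(H)) : set 'End(H) :=
  [set T | forall e : R, 0 < e -> exists2 S, A S & opnorm (T - S) < e].

End Norm.

Section Idempotents.
Context (R : realType) (H : vectType R[i]).

Definition idempotents : set 'End(H) := [set E | (E \o E)%VF = E].

Definition idempotent_commutators : set 'End(H) :=
  [set (E \o F)%VF - (F \o E)%VF | E in idempotents & F in idempotents].

End Idempotents.

Section Integral.
Context (R : realType) (V : vectType R[i]).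

Definition complex_integral (a b : R) (f : R -> R[i]) : R[i] :=
  (\int[lebesgue_measure]_(t in `[a, b]) complex.Re (f t))%R +i*
  (\int[lebesgue_measure]_(t in `[a, b]) complex.Im (f t))%R.

(* The value does not depend on the basis used. *)
Definition vector_integral (a b : R) (f : R -> V) : V :=
  \sum_(k < \dim {:V})
     complex_integral a b (fun t => coord (vbasis {:V}) k (f t))
       *: (vbasis {:V})`_k.

Definition circle_point (c : R[i]) (r t : R) : R[i] :=
  c + r%:C * (cos t +i* sin t).

(* The integral of [f z dz] over the positively oriented circle |z - c| = r. *)
Definition circle_integral (c : R[i]) (r : R) (f : R[i] -> V) : V :=
  vector_integral 0 (2 * pi) (fun t =>
    ('i * (r%:C * (cos t +i* sin t))) *: f (circle_point c r t)).

End Integral.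

Section Operators.
Context (R : realType) (H : vectType R[i]).
Implicit Types (T S E : 'End(H)) (a z : R[i]) (Omega : set R[i]).

Definition sub_scalar T a : 'End(H) := T - a *: \1%VF.

Definition spectrum T : set R[i] :=
  [set a | ~ exists S, (S \o sub_scalar T a)%VF = \1%VF /\
                       (sub_scalar T a \o S)%VF = \1%VF].

(* A Cauchy domain for the part of the spectrum of T in Omega: finitely many
   discs d = (centre, radius), with pairwise disjoint closures, which together
   contain spectrum T `&` Omega and whose closures miss the remainder of the
   spectrum.  The spectrum being finite here, such a family of discs always
   exists, so that no other shapes of contours are needed. *)
Definition cauchy_discs T Omega (D : seq (R[i] * R)) : Prop :=
  [/\ uniq D /\ (forall d, d \in D -> 0 < d.2),
      forall d e, d \in D -> e \in D -> d != e ->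
        forall z, ~ (`|z - d.1| <= d.2%:C /\ `|z - e.1| <= e.2%:C),
      forall z, spectrum T z -> Omega z ->
        exists2 d, d \in D & `|z - d.1| < d.2%:C
    & forall z, spectrum T z -> ~ Omega z ->
        forall d, d \in D -> ~ (`|z - d.1| <= d.2%:C)].

(* The resolvent (z - T)^-1; z is always in the resolvent set when it is
   used, so that (_ ^-1)%VF is the genuine inverse. *)
Definition resolvent T z : 'End(H) := ((z *: \1 - T)^-1)%VF.

(* (2 pi i)^-1 times the integral of the resolvent over the boundary of a Cauchy
   domain; by Cauchy's theorem the choice of the domain is immaterial. *)
Definition riesz_idempotent Omega T : 'End(H) :=
  (2 * pi%:C * 'i)^-1 *:
    \sum_(d <- xget [::] [set D | cauchy_discs T Omega D])
       circle_integral d.1 d.2 (resolvent T).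

Definition riesz_space Omega T : {vspace H} :=
  limg (riesz_idempotent Omega T).

End Operators.

Section Balanced.
Context (R : realType) (H : vectType R[i]) (dot : {dot H for Num.conj}).
Implicit Types (T : 'End(H)) (a : R[i]).

Definition adjoint T : 'End(H) :=
  xget 0 [set S : 'End(H) | forall x y, dot (T x) y = dot x (S y)].

Definition closed_range T : Prop :=
  forall y, (forall e : R, 0 < e -> exists x, hilbert_norm dot (y - T x) < e) ->
    y \in limg T.

(* Dimensions are natural numbers here, so the finiteness condition holds
   automatically; it is kept to follow the general definition. *)
Definition semi_fredholm T : Prop :=
  closed_range T /\
  (mine (\dim (lker T))%:R%:E (\dim (lker (adjoint T)))%:R%:E < +oo :> \bar R)%E.

Definition fredholm_index T : int :=
  (\dim (lker T))%:Z - (\dim (lker (adjoint T)))%:Z.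

Definition balanced T : Prop :=
  [/\ spectrum T = spectrum (- T),
      forall Omega1 Omega2 : set (R[i] : numFieldType),
        open Omega1 -> open Omega2 -> Omega1 `&` Omega2 = set0 ->
        spectrum T `<=` Omega1 `|` Omega2 ->
        \dim (riesz_space Omega1 T) = \dim (riesz_space (-%R @` Omega1) T)
    & forall a,
        (semi_fredholm (sub_scalar T a) <-> semi_fredholm (sub_scalar T (- a))) /\
        (semi_fredholm (sub_scalar T a) ->
           fredholm_index (sub_scalar T a) = fredholm_index (sub_scalar T (- a)))].

End Balanced.

(* Main.v *)
Require Import Defs.
From mathcomp Require Import all_boot all_order all_algebra.
From mathcomp Require Import complex.
From mathcomp Require Import all_classical all_reals all_analysis.
From mathcomp Require Import perm zify ring.
Import Order.TTheory GRing.Theory Num.Theory.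
Import numFieldNormedType.Exports.
Local Open Scope classical_set_scope.
Local Open Scope ring_scope.
Local Open Scope complex_scope.
Set Implicit Arguments.
Unset Strict Implicit.

(** Both sides of the equality are shown to consist of the operators [T] whose
    eigenvalues, counted with algebraic multiplicity, are symmetric under
    negation. In triangular coordinates ([trig_coords]) this says that an
    involution [p] of the indices satisfies [a (p i) = - a i], where [a] is the
    diagonal of the matrix of [T] (the predicate [paired]).

    Closure of commutators. If [E] and [F] are idempotents and [X = 2 E - 1],
    then [X ^ 2 = 1] and conjugation by [X] changes the sign of [E F - F E].
    Hence the characteristic polynomial of a commutator satisfies
    [chi z = (-1) ^ n chi (- z)], and by continuity of the determinant so does
    that of a limit ([det_symmetric_limit]); its roots are then symmetric
    ([trig_det_symmetric_paired]). Conversely, a diagonal matrix with paired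
    entries is explicitly a commutator of idempotents
    ([diag_idempotent_commutator]): each plane spanned by the basis vectors of
    indices [i] and [p i] carries two suitable involutions. A triangular matrix
    with paired diagonal becomes diagonalizable, its diagonal still paired, after
    an arbitrarily small perturbation of the diagonal ([paired_perturbation]).

    Balanced operators. Every operator on a finite-dimensional space has closed
    range and index 0, so that only the conditions on the spectrum matter, and
    the point is that the range of the Riesz idempotent over [Omega] has as
    dimension the number of diagonal entries in [Omega] ([dim_riesz_space]). The
    generalized eigenvectors span the space ([gen_span_shift]), so that the
    resolvent is a finite sum of terms [X / (z - a) ^ (k + 1)]
    ([resolvent_expansion]). Integration over the circles of a Cauchy domain
    keeps exactly the coefficients [X] of the simple poles in [Omega]
    ([circle_kernel_integral], [riesz_idempotent_expansion]). Therefore the Riesz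
    idempotent and its complement are annihilated by products of [T - a] over
    eigenvalues [a] inside, respectively outside [Omega]; the rank of a
    triangular matrix being at least the number of its nonzero diagonal entries,
    this bounds their ranks by two numbers whose sum is [n]. Small discs around an
    eigenvalue and its negative then show that balanced operators are paired. *)

(** * Integrals of rational functions over circles *)

Section ComplexIntegral.
Context (R : realType).
Implicit Types (f g : R -> R[i]) (c w : R[i]) (m k : nat).
Local Notation Re := (@complex.Re R).
Local Notation Im := (@complex.Im R).
Local Notation mu := (@lebesgue_measure R).

(** Continuity of the real and imaginary parts, which are integrated separately
    in [complex_integral]. *)
Definition ccontinuous f :=
  continuous (fun t => Re (f t)) /\ continuous (fun t => Im (f t)).

Lemma ccontinuous_cst c : ccontinuous (fun=> c).
Proof. by split; move=> t; exact: cvg_cst. Qed.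

Lemma ccontinuousD f g :
  ccontinuous f -> ccontinuous g -> ccontinuous (fun t => f t + g t).
Proof.
move=> [f1 f2] [g1 g2]; split => t.
  rewrite (_ : (fun _ => _) = (fun t => Re (f t) + Re (g t))); last first.
    by apply/funext => s; case: (f s) => ? ?; case: (g s).
  by apply: cvgD; [exact: f1|exact: g1].
rewrite (_ : (fun _ => _) = (fun t => Im (f t) + Im (g t))); last first.
  by apply/funext => s; case: (f s) => ? ?; case: (g s).
by apply: cvgD; [exact: f2|exact: g2].
Qed.

Lemma ccontinuousM f g :
  ccontinuous f -> ccontinuous g -> ccontinuous (fun t => f t * g t).
Proof.
move=> [f1 f2] [g1 g2]; split => t.
  rewrite (_ : (fun _ => _) =
      (fun t => Re (f t) * Re (g t) - Im (f t) * Im (g t))); last first.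
    by apply/funext => s; case: (f s) => ? ?; case: (g s).
  by apply: cvgB; apply: cvgM; [exact: f1|exact: g1|exact: f2|exact: g2].
rewrite (_ : (fun _ => _) =
    (fun t => Re (f t) * Im (g t) + Im (f t) * Re (g t))); last first.
  by apply/funext => s; case: (f s) => ? ?; case: (g s).
by apply: cvgD; apply: cvgM; [exact: f1|exact: g2|exact: f2|exact: g1].
Qed.

Lemma ccontinuousX f k : ccontinuous f -> ccontinuous (fun t => f t ^+ k).
Proof.
move=> cf; elim: k => [|k IH].
  by under eq_fun do rewrite expr0; exact: ccontinuous_cst.
by under eq_fun do rewrite exprS; exact: ccontinuousM.
Qed.

Lemma ccontinuousV f :
  ccontinuous f -> (forall t, f t != 0) -> ccontinuous (fun t => (f t)^-1).
Proof.
move=> [f1 f2] f0.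
pose q t := (Re (f t) ^+ 2 + Im (f t) ^+ 2)^-1.
have cq : continuous q.
  move=> t; apply: cvgV; last first.
    by apply: cvgD; apply: cvgM; [exact: f1|exact: f1|exact: f2|exact: f2].
  have := f0 t; apply: contra => /eqP h.
  have : (Re (f t) ^+ 2 + Im (f t) ^+ 2)%:C = 0 :> R[i] by rewrite h.
  by rewrite add_Re2_Im2 => /eqP; rewrite sqrf_eq0 normr_eq0.
split => t.
  rewrite (_ : (fun _ => _) = (fun t => Re (f t) * q t)); last first.
    by apply/funext => s; rewrite /q; case: (f s).
  by apply: cvgM; [exact: f1|exact: cq].
rewrite (_ : (fun _ => _) = (fun t => - Im (f t) * q t)); last first.
  by apply/funext => s; rewrite /q; case: (f s) => a b /=; rewrite mulNr.
by apply: cvgM; [apply: cvgN; exact: f2|exact: cq].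
Qed.

Lemma integrable_of_continuous (a b : R) (f : R -> R) :
  continuous f -> mu.-integrable `[a, b] (EFin \o f).
Proof.
move=> cf; apply: continuous_compact_integrable; first exact: segment_compact.
exact: continuous_subspaceT.
Qed.

Lemma complex_integralD a b f g : ccontinuous f -> ccontinuous g ->
  complex_integral a b (fun t => f t + g t) =
  complex_integral a b f + complex_integral a b g.
Proof.
move=> [f1 f2] [g1 g2]; rewrite /complex_integral.
have I h := @integrable_of_continuous a b h.
apply/eqP; rewrite eq_complex /= -!RintegralD ?I//.
by apply/andP; split; apply/eqP; apply: eq_Rintegral => t _;
  case: (f t) => ? ?; case: (g t).
Qed.

Lemma complex_integralZ a b c f : ccontinuous f ->
  complex_integral a b (fun t => c * f t) = c * complex_integral a b f.
Proof.
move=> [f1 f2]; rewrite /complex_integral.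
have I h := @integrable_of_continuous a b h.
case: c => p q; apply/eqP; rewrite eq_complex /= -!RintegralZl ?I//.
have cont (k : R) (h : R -> R) :
    continuous h -> continuous (fun t : R => (k * h t : R)).
  by move=> ch t; apply: cvgM; [exact: cvg_cst|exact: ch].
rewrite -RintegralB ?I//; [|exact: cont..].
rewrite -RintegralD ?I//; [|exact: cont..].
by apply/andP; split; apply/eqP; apply: eq_Rintegral => t _; case: (f t).
Qed.

Lemma complex_integral_cst b c : 0 <= b ->
  complex_integral 0 b (fun=> c) = b%:C * c.
Proof.
move=> b0; rewrite /complex_integral !Rintegral_cst //=.
rewrite lebesgue_measure_itv/= lte_fin.
case: ltgtP b0 => // [b0 _|<- _] /=.
  by case: c => p q; rewrite oppr0 addr0 /=; simpc; rewrite ![_ * b]mulrC.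
by case: c => p q; simpc.
Qed.

Lemma le_complex_integral b (B : R) f : 0 <= b -> ccontinuous f ->
  (forall t, `|f t| <= B%:C) ->
  `|complex_integral 0 b f| <= (2 * (b * B))%:C.
Proof.
move=> b0 [f1 f2] fB.
have I h := @integrable_of_continuous 0 b h.
have H (h : R -> R) : continuous h -> (forall t, `|h t| <= B) ->
    `|\int[mu]_(t in `[0, b]) h t| <= b * B.
  move=> ch hB; apply: le_trans (le_normr_Rintegral _ _) _ => //.
    exact: I.
  rewrite (_ : b * B = \int[mu]_(t in `[0, b]) B); last first.
    rewrite Rintegral_cst //= lebesgue_measure_itv/= lte_fin mulrC.
    by case: ltgtP b0 => // [b0 _|<- _] /=; rewrite ?oppr0 ?addr0.
  apply: le_Rintegral => //; apply: I => t; last exact: cvg_cst.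
  exact: (cvg_norm (ch t)).
rewrite [X in `|X|]complexE; apply: le_trans (ler_normD _ _) _.
rewrite normrM /= complexiE normCi mul1r.
have nC (x : R) : `|x%:C| = `|x|%:C.
  by rewrite normc_def /= expr0n /= addr0 sqrtr_sqr.
rewrite !nC -rmorphD lecR mulr_natl mulr2n; apply: lerD; apply: H => // t.
  by rewrite -lecR; apply: le_trans (fB t); exact: normc_ge_Re.
rewrite -lecR; apply: le_trans (fB t).
(* [- Im z] is the real part of [z * 'i]. *)
rewrite -normrN -ReiNIm -[leRHS]mulr1 -(@normCi R[i]) -complexiE -normrM.
exact: normc_ge_Re.
Qed.

Lemma Rintegral_derivative (f F : R -> R) (b : R) : 0 < b -> continuous f ->
  (forall t : R, derivable F t 1 /\ 'D_1 F t = f t) ->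
  \int[mu]_(t in `[0, b]) f t = F b - F 0.
Proof.
move=> b0 cf dF; rewrite /Rintegral (@continuous_FTC2 _ f F)//.
- exact: continuous_subspaceT.
- have dF1 (t : R) : derivable F t (1:R) by case: (dF t).
  have cF (t : R) : {for t, continuous F}.
    by apply: differentiable_continuous; apply/derivable1_diffP.
  split.
  + by move=> t _; exact: dF1.
  + by apply: cvg_at_right_filter; exact: cF.
  + by apply: cvg_at_left_filter; exact: cF.
- by move=> t _; rewrite derive1E; case: (dF t).
Qed.

Definition cis (t : R) : R[i] := cos t +i* sin t.

Lemma cisX t m : cis t ^+ m = cis (m%:R * t).
Proof.
elim: m => [|m IH]; first by rewrite expr0 mulr0n mul0r /cis cos0 sin0.
rewrite exprS IH -natr1 mulrDl mul1r addrC /cis cosD sinD.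
by apply/eqP; rewrite eq_complex /=; apply/andP; split; apply/eqP; ring.
Qed.

Lemma normr_cis t : `|cis t| = 1.
Proof. by rewrite normc_def /= cos2Dsin2 sqrtr1. Qed.

Lemma cis_neq0 t : cis t != 0.
Proof. by rewrite -normr_eq0 normr_cis oner_eq0. Qed.

Lemma cisVE t : (cis t)^-1 = (cis t)^*%C.
Proof. by rewrite invc_norm normr_cis expr1n invr1 mul1r. Qed.

Lemma ccontinuous_cis : ccontinuous cis.
Proof. by split => t; [exact: continuous_cos|exact: continuous_sin]. Qed.

Lemma complex_integral_cisX m : (0 < m)%N ->
  complex_integral 0 (2 * pi) (fun t => cis t ^+ m) = 0.
Proof.
move=> m0; have mR : m%:R != 0 :> R by rewrite pnatr_eq0 -lt0n.
have p0 : 0 < 2 * pi :> R by rewrite mulr_gt0 ?pi_gt0.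
have [c1 s0] : cos (m%:R * (2 * pi)) = 1 :> R /\
    sin (m%:R * (2 * pi)) = 0 :> R.
  have : cis (2 * pi) ^+ m = 1.
    by rewrite {1}/cis mulr_natl cos2pi sin2pi expr1n.
  by rewrite cisX => -[].
rewrite /complex_integral.
have cf (h : R -> R) : continuous h -> continuous (fun t : R => h (m%:R * t)).
  move=> ch t.
  apply: (@continuous_comp R R R (fun t : R => m%:R * t : R) h); last exact: ch.
  by apply: cvgM; [exact: cvg_cst|exact: cvg_id].
under eq_Rintegral do rewrite cisX /=.
rewrite (@Rintegral_derivative _ (fun t => m%:R^-1 * sin (m%:R * t)))//; last first.
- move=> t; split; first exact: ex_derive.
  by rewrite derive_val /GRing.scale/=; field; exact: mR.
- by apply: cf; exact: continuous_cos.
under eq_Rintegral do rewrite cisX /=.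
rewrite (@Rintegral_derivative _ (fun t => - m%:R^-1 * cos (m%:R * t)))//; last first.
- move=> t; split; first exact: ex_derive.
  by rewrite derive_val /GRing.scale/=; field; exact: mR.
- by apply: cf; exact: continuous_sin.
by rewrite s0 c1 !mulr0 sin0 cos0 mulr0 !subrr.
Qed.

Lemma complex_integral_cisV m : (0 < m)%N ->
  complex_integral 0 (2 * pi) (fun t => (cis t)^-1 ^+ m) = 0.
Proof.
move=> m0; have := complex_integral_cisX m0; rewrite /complex_integral => -[h1 h2].
have E t : (cis t)^-1 ^+ m = (cis t ^+ m)^*%C by rewrite cisVE -rmorphXn.
apply/eqP; rewrite eq_complex /=; apply/andP; split; apply/eqP.
  rewrite -[RHS]h1; apply: eq_Rintegral => t _; rewrite E.
  by case: (_ ^+ m).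
transitivity (- 1 * \int[mu]_(t in `[0, 2 * pi]) Im (cis t ^+ m)); last first.
  by rewrite h2 mulr0.
rewrite -RintegralZl//; last first.
  by apply: integrable_of_continuous; exact: (ccontinuousX _ ccontinuous_cis).2.
apply: eq_Rintegral => t _; rewrite E.
by case: (_ ^+ m) => ? ? /=; rewrite mulN1r.
Qed.

(** Iterating the recurrence gives [x m = q ^+ k * x (m + k)] for all [k], and
    the right-hand side tends to 0. *)
Lemma geometric_decay_eq0 (x : nat -> R[i]) (q : R[i]) (B : R) :
  `|q| < 1 -> (forall m, x m = q * x m.+1) -> (forall m, `|x m| <= B%:C) ->
  forall m, x m = 0.
Proof.
move=> q1 xS xB m.
have xk k : x m = q ^+ k * x (m + k)%N.
  elim: k => [|k IH]; first by rewrite expr0 mul1r addn0.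
  by rewrite IH xS mulrA -exprSr addnS.
have nE (z : R[i]) : `|z| = (Re `|z|)%:C.
  by rewrite [RHS]RRe_real ?normr_real.
have r1 : `|Re `|q| | < 1.
  rewrite ger0_norm; first by rewrite -ltcR -nE; exact: q1.
  by rewrite -lecR -nE; exact: normr_ge0.
have le k : Re `|x m| <= Re `|q| ^+ k * B.
  rewrite -lecR -nE rmorphM rmorphXn /= -nE (xk k) normrM normrX.
  by rewrite ler_wpM2l ?exprn_ge0.
have /(cvgM (cvg_expr r1)) : (fun=> B) @ \oo --> B by exact: cvg_cst.
rewrite mul0r => lim0; apply/eqP; rewrite -normr_le0 nE lecR.
apply: (ler_cvg_to (cvg_cst _) lim0).
by apply: nearW => k; exact: le.
Qed.

(** The functions [v ^+ m * (1 - q v) ^- j] with [v] on the unit circle behave as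
    power series in [v]: their mean is their constant term. They include the
    kernels of Cauchy's formula, with [v t = (cis t)^-1] for a pole inside the
    circle and [v t = cis t] for a pole outside. *)
Section MeanValue.
Context (v : R -> R[i]) (q : R[i]).
Hypothesis v1 : forall t, `|v t| = 1.
Hypothesis cv : ccontinuous v.
Hypothesis v_int : forall m, (0 < m)%N ->
  complex_integral 0 (2 * pi) (fun t => v t ^+ m) = 0.
Hypothesis q1 : `|q| < 1.

Let G m j t := v t ^+ m * (1 - q * v t)^-1 ^+ j.

Let denom_bound t : 1 - `|q| <= `|1 - q * v t|.
Proof.
apply: le_trans (lerB_dist _ _).
by rewrite normr1 normrM v1 mulr1.
Qed.

Let denom_neq0 t : 1 - q * v t != 0.
Proof.
by rewrite -normr_gt0; apply: lt_le_trans (denom_bound t); rewrite subr_gt0.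
Qed.

Lemma ccontinuous_kernel m j :
  ccontinuous (fun t => v t ^+ m * (1 - q * v t)^-1 ^+ j).
Proof.
apply: ccontinuousM; first exact: ccontinuousX.
apply: ccontinuousX; apply: ccontinuousV => //.
rewrite (_ : (fun _ => _) = (fun t => 1 + (- q) * v t)); last first.
  by apply/funext => t; rewrite mulNr.
by apply: ccontinuousD; [|apply: ccontinuousM => //]; exact: ccontinuous_cst.
Qed.

Let cG m j : ccontinuous (G m j) := ccontinuous_kernel m j.

Let G_bound j : exists B : R, forall m t, `|G m j t| <= B%:C.
Proof.
exists (Re ((1 - `|q|)^-1 ^+ j)) => m t.
have q0 : 0 < 1 - `|q| by rewrite subr_gt0.
rewrite RRe_real; last by rewrite ger0_real// exprn_ge0// invr_ge0 ltW.
rewrite /G normrM normrX v1 expr1n mul1r normrX normfV.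
by rewrite lerXn2r ?nnegrE ?invr_ge0 ?normr_ge0 ?(ltW q0)// lef_pV2 ?posrE ?normr_gt0.
Qed.

Let p0 : 0 <= 2 * pi :> R. Proof. by rewrite mulr_ge0 ?pi_ge0. Qed.

Let G_rec m j t : G m j.+1 t = G m j t + q * G m.+1 j.+1 t.
Proof. by rewrite /G !exprS; field; rewrite denom_neq0. Qed.

(** From [(1 - q v)^-1 = 1 + q v (1 - q v)^-1], the integrals for [j + 1] are
    [q] times the integrals for a larger [m], up to integrals for [j]; being
    bounded uniformly in [m], they vanish. *)
Lemma integral_positive_frequency m j : (0 < m)%N ->
  complex_integral 0 (2 * pi) (fun t => v t ^+ m * (1 - q * v t)^-1 ^+ j) = 0.
Proof.
case: m => // m _; elim: j m => [|j IH] m.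
  by under eq_fun do rewrite expr0 mulr1; exact: v_int.
have [B GB] := G_bound j.+1.
apply: (@geometric_decay_eq0
  (fun m => complex_integral 0 (2 * pi) (G m.+1 j.+1)) q (2 * (2 * pi * B))) => //.
- move=> {}m; rewrite (_ : G m.+1 j.+1 =
      (fun t => G m.+1 j t + q * G m.+2 j.+1 t)); last exact/funext/G_rec.
  rewrite complex_integralD ?complex_integralZ ?IH ?add0r//.
  by apply: ccontinuousM => //; exact: ccontinuous_cst.
- by move=> {}m; exact: le_complex_integral.
Qed.

Lemma integral_zero_frequency j :
  complex_integral 0 (2 * pi) (fun t => (1 - q * v t)^-1 ^+ j) = (2 * pi)%:C.
Proof.
elim: j => [|j IH].
  under eq_fun do rewrite expr0.
  by rewrite complex_integral_cst// mulr1.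
rewrite (_ : (fun _ => _) = (fun t => G 0 j t + q * G 1 j.+1 t)); last first.
  by apply/funext => t; rewrite -G_rec /G expr0 mul1r.
rewrite complex_integralD//; last first.
  by apply: ccontinuousM => //; exact: ccontinuous_cst.
rewrite complex_integralZ// (@integral_positive_frequency 1)//.
rewrite mulr0 addr0 -IH; congr (complex_integral _ _ _).
by apply/funext => t; rewrite /G expr0 mul1r.
Qed.

End MeanValue.

Lemma circle_kernel_inside w j : `|w| < 1 ->
  complex_integral 0 (2 * pi) (fun t => cis t * (cis t - w)^-1 ^+ j.+1) =
  if j == 0%N then (2 * pi)%:C else 0.
Proof.
move=> w1.
have v1 t : `|(cis t)^-1| = 1 by rewrite normfV normr_cis invr1.
have cv : ccontinuous (fun t => (cis t)^-1).
  by apply: ccontinuousV; [exact: ccontinuous_cis|exact: cis_neq0].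
have -> : (fun t => cis t * (cis t - w)^-1 ^+ j.+1) =
    (fun t => (cis t)^-1 ^+ j * (1 - w * (cis t)^-1)^-1 ^+ j.+1).
  apply/funext => t; have c0 := cis_neq0 t.
  have -> : (1 - w * (cis t)^-1)^-1 = cis t * (cis t - w)^-1.
    by rewrite -(divff c0) -mulrBl invfM invrK mulrC.
  by rewrite exprMn mulrA [cis t ^+ _]exprSr mulrA -exprMn mulVf// expr1n mul1r.
case: j => [|j]; last first.
  exact: (integral_positive_frequency v1 cv complex_integral_cisV w1).
under eq_fun do rewrite expr0 mul1r.
exact: (integral_zero_frequency v1 cv complex_integral_cisV w1).
Qed.

Lemma circle_kernel_outside w j : 1 < `|w| ->
  complex_integral 0 (2 * pi) (fun t => cis t * (cis t - w)^-1 ^+ j.+1) = 0.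
Proof.
move=> w1; have w0 : w != 0 by rewrite -normr_gt0 (lt_trans _ w1).
have q1 : `|w^-1| < 1 by rewrite normfV invf_lt1// normr_gt0.
have -> : (fun t => cis t * (cis t - w)^-1 ^+ j.+1) =
    (fun t => (- w^-1) ^+ j.+1 * (cis t ^+ 1 * (1 - w^-1 * cis t)^-1 ^+ j.+1)).
  apply/funext => t.
  have -> : cis t - w = (- w) * (1 - w^-1 * cis t).
    by rewrite mulrBr mulr1 mulrA mulNr divff// mulN1r opprK addrC.
  by rewrite invfM exprMn invrN mulrCA expr1.
rewrite complex_integralZ ?(@integral_positive_frequency cis) ?mulr0//.
- exact: normr_cis.
- exact: ccontinuous_cis.
- exact: complex_integral_cisX.
- by apply: ccontinuous_kernel => //; [exact: normr_cis|exact: ccontinuous_cis].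
Qed.

Lemma circle_point_subE c (r : R) w t : r != 0 ->
  circle_point c r t - w = r%:C * (cis t - (w - c) / r%:C).
Proof.
move=> r0; have r0C : r%:C != 0.
  by rewrite -(rmorph0 (real_complex R)) (inj_eq (@complexI R)).
by rewrite mulrBr mulrCA divff// mulr1 /circle_point -/(cis t) opprB addrCA addrA.
Qed.

Lemma circle_point_neq c (r : R) w t : 0 < r -> `|w - c| != r%:C ->
  circle_point c r t != w.
Proof.
move=> r0; apply: contra => /eqP <-.
rewrite /circle_point addrC addKr normrM -/(cis t) normr_cis mulr1.
by rewrite ger0_norm// ler0c ltW.
Qed.

(** The integrand of [dz / (z - w) ^ (j + 1)] over the circle. *)
Definition circle_kernel c (r : R) w j t : R[i] :=
  'i * (r%:C * cis t) * (circle_point c r t - w)^-1 ^+ j.+1.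

Lemma ccontinuous_circle_kernel c (r : R) w j : 0 < r -> `|w - c| != r%:C ->
  ccontinuous (circle_kernel c r w j).
Proof.
move=> r0 wr.
apply: ccontinuousM.
  do 2![apply: ccontinuousM; first exact: ccontinuous_cst].
  exact: ccontinuous_cis.
apply: ccontinuousX; apply: ccontinuousV; last first.
  by move=> t; rewrite subr_eq0; exact: circle_point_neq.
apply: ccontinuousD; last exact: ccontinuous_cst.
apply: ccontinuousD; first exact: ccontinuous_cst.
by apply: ccontinuousM; [exact: ccontinuous_cst|exact: ccontinuous_cis].
Qed.

Lemma circle_kernel_integral c (r : R) w j : 0 < r -> `|w - c| != r%:C ->
  complex_integral 0 (2 * pi) (circle_kernel c r w j) =
  if (j == 0%N) && (`|w - c| < r%:C) then 2 * pi%:C * 'i else 0.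
Proof.
move=> r0 wr; have rC0 : 0 < r%:C by rewrite -(rmorph0 (real_complex R)) ltcR.
have rC := lt0r_neq0 rC0.
set v := (w - c) / r%:C.
have nv : `|v| = `|w - c| / r%:C by rewrite normrM normfV (gtr0_norm rC0).
pose g t := cis t * (cis t - v)^-1 ^+ j.+1.
have E : circle_kernel c r w j = (fun t => 'i * (r%:C)^-1 ^+ j * g t).
  apply/funext => t; rewrite /circle_kernel circle_point_subE ?lt0r_neq0// -/v /g.
  rewrite invfM exprMn (exprS r%:C^-1 j).
  set X := r%:C^-1 ^+ j; set Y := (_ - v)^-1 ^+ _.
  transitivity ('i * X * (cis t * Y) * (r%:C * r%:C^-1)); first by ring.
  by rewrite divff ?mulr1.
have cg : ccontinuous g.
  have -> : g = fun t => (('i * (r%:C)^-1 ^+ j)^-1 * circle_kernel c r w j t).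
    apply/funext => t; rewrite E mulKf// mulf_neq0 ?expf_neq0 ?invr_eq0//.
    exact: neq0Ci.
  apply: ccontinuousM; first exact: ccontinuous_cst.
  exact: ccontinuous_circle_kernel.
rewrite E complex_integralZ//.
have [wlt|] := boolP (`|w - c| < r%:C).
  have v1 : `|v| < 1 by rewrite nv ltr_pdivrMr// mul1r.
  rewrite circle_kernel_inside//; case: eqP => [->|_] /=; last by rewrite mulr0.
  by rewrite expr0 mulr1 mulrC rmorphM /= rmorph_nat.
rewrite andbF -real_leNgt ?normr_real ?gtr0_real//.
rewrite le_eqVlt eq_sym (negbTE wr) /= => wgt.
by rewrite circle_kernel_outside ?mulr0// nv ltr_pdivlMr// mul1r.
Qed.

Lemma complex_integral_sum a b (I : eqType) (L : seq I) (g : I -> R -> R[i]) :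
  (forall i, i \in L -> ccontinuous (g i)) ->
  complex_integral a b (fun t => \sum_(i <- L) g i t) =
  \sum_(i <- L) complex_integral a b (g i).
Proof.
move=> cg.
suff [] : ccontinuous (fun t => \sum_(i <- L) g i t) /\
  complex_integral a b (fun t => \sum_(i <- L) g i t) =
  \sum_(i <- L) complex_integral a b (g i) by [].
elim: L cg => [_|i0 L IH cg].
  rewrite big_nil; under eq_fun do rewrite big_nil; split.
    exact: ccontinuous_cst.
  have := @complex_integralZ a b 0 (fun=> 0) (ccontinuous_cst 0).
  by rewrite !mul0r.
have [] := IH (fun i iL => cg i (@mem_behead _ (i0 :: L) i iL)).
have ci := cg i0 (mem_head i0 L).
move=> cL EL; rewrite big_cons; under eq_fun do rewrite big_cons; split.
  exact: ccontinuousD.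
by rewrite complex_integralD// EL.
Qed.

Lemma vector_integral_sum (V : vectType R[i]) a b (I : eqType) (L : seq I)
    (g : I -> R -> R[i]) (y : I -> V) :
  (forall i, i \in L -> ccontinuous (g i)) ->
  vector_integral a b (fun t => \sum_(i <- L) g i t *: y i) =
  \sum_(i <- L) complex_integral a b (g i) *: y i.
Proof.
move=> cg; rewrite /vector_integral.
transitivity (\sum_(k < \dim {:V}) \sum_(i <- L)
    (complex_integral a b (g i) * coord (vbasis {:V}) k (y i)) *: (vbasis {:V})`_k).
  apply: eq_bigr => k _; rewrite -scaler_suml; congr (_ *: _).
  transitivity (complex_integral a b
      (fun t => \sum_(i <- L) coord (vbasis {:V}) k (y i) * g i t)).
    congr (complex_integral a b _); apply/funext => t; rewrite linear_sum.
    by apply: eq_bigr => i _; rewrite linearZ; exact: mulrC.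
  rewrite complex_integral_sum; last first.
    by move=> i iL; apply: ccontinuousM; [exact: ccontinuous_cst|exact: cg].
  rewrite !big_seq; apply: eq_bigr => i iL.
  rewrite complex_integralZ; [exact: mulrC|exact: cg].
rewrite exchange_big /=; apply: eq_bigr => i _.
rewrite [y i in RHS](coord_vbasis (memvf (y i))) scaler_sumr.
by apply: eq_bigr => k _; rewrite scalerA.
Qed.

Lemma circle_integral_sum (V : vectType R[i]) c (r : R) (I : eqType) (L : seq I)
    (w : I -> R[i]) (j : I -> nat) (y : I -> V) :
  0 < r -> (forall i, i \in L -> `|w i - c| != r%:C) ->
  circle_integral c r (fun z => \sum_(i <- L) (z - w i)^-1 ^+ (j i).+1 *: y i) =
  (2 * pi%:C * 'i) *: \sum_(i <- L | (j i == 0%N) && (`|w i - c| < r%:C)) y i.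
Proof.
move=> r0 wr; rewrite /circle_integral.
transitivity (vector_integral 0 (2 * pi)
    (fun t => \sum_(i <- L) circle_kernel c r (w i) (j i) t *: y i)).
  congr (vector_integral _ _ _); apply/funext => t; rewrite scaler_sumr.
  by apply: eq_bigr => i _; rewrite scalerA.
rewrite vector_integral_sum; last first.
  by move=> i iL; apply: ccontinuous_circle_kernel => //; exact: wr.
rewrite scaler_sumr [RHS]big_mkcond [LHS]big_seq [RHS]big_seq.
apply: eq_bigr => i iL; rewrite circle_kernel_integral ?wr//.
by case: ifP; rewrite ?scale0r.
Qed.

End ComplexIntegral.

(** * Triangular matrices *)

Section Triangular.
Context (F : fieldType).

Lemma trig_mulmx n (A B : 'M[F]_n) : is_trig_mx A -> is_trig_mx B ->
  is_trig_mx (A *m B) /\ (forall i, (A *m B) i i = A i i * B i i).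
Proof.
move=> /is_trig_mxP tA /is_trig_mxP tB; split.
  apply/is_trig_mxP => i j ij; rewrite mxE big1// => k _.
  have [ik|ki] := ltnP i k; first by rewrite tA ?mul0r.
  by rewrite tB ?mulr0// (leq_ltn_trans ki).
move=> i; rewrite mxE (bigD1 i)//= big1 ?addr0// => k; rewrite neq_ltn.
by case/orP => ?; [rewrite tB ?mulr0|rewrite tA ?mul0r].
Qed.

Lemma trig_addmx n (A B : 'M[F]_n) : is_trig_mx A -> is_trig_mx B ->
  is_trig_mx (A + B).
Proof.
move=> /is_trig_mxP tA /is_trig_mxP tB; apply/is_trig_mxP => i j ij.
by rewrite mxE tA ?tB ?addr0.
Qed.

Lemma rank_diag_mx_le n (d : 'rV[F]_n) :
  (\rank (diag_mx d) <= #|[pred i | d ord0 i != 0%R]|)%N.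
Proof.
have -> : diag_mx d = \sum_(i in [pred i | d 0 i != 0]) d 0 i *: delta_mx i i.
  rewrite diag_mx_sum_delta [RHS]big_mkcond /=; apply: eq_bigr => i _.
  by rewrite inE; case: eqP => [->|]//; rewrite scale0r.
rewrite -sum1_card; apply: (big_ind2 (fun M k => \rank M <= k)%N).
- by rewrite mxrank0.
- by move=> M k M' k' Mk Mk'; apply: leq_trans (mxrank_add _ _) _; exact: leq_add.
- by move=> i _; apply: leq_trans (mxrank_scale _ _) _; rewrite mxrank_delta.
Qed.

(** Replacing the zeros on the diagonal by ones makes the matrix invertible, and
    this changes the rank by at most the number of these zeros. *)
Lemma trig_rank_ge n (N : 'M[F]_n) : is_trig_mx N ->
  (#|[pred i | N i i != 0%R]| <= \rank N)%N.
Proof.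
move=> tN; pose d : 'rV[F]_n := \row_i (N i i == 0)%:R.
have rD : (\rank (diag_mx d) <= #|[predC [pred i | N i i != 0%R]]|)%N.
  apply: leq_trans (rank_diag_mx_le _) _; apply: subset_leq_card.
  by apply/fintype.subsetP => i; rewrite !inE mxE negbK; case: (N i i == 0) => //=; rewrite eqxx.
have uND : N + diag_mx d \in unitmx.
  rewrite unitmxE det_trig ?trig_addmx ?diag_mx_is_trig// unitfE prodf_seq_neq0.
  apply/allP => i _ /=; rewrite !mxE eqxx mulr1n.
  by have [->|] := eqVneq (N i i) 0; rewrite ?add0r ?oner_eq0 ?addr0.
have := mxrank_add N (diag_mx d).
rewrite (eqP (_ : row_free (N + diag_mx d))) ?row_free_unit//.
have := cardC [pred i | N i i != 0%R]; rewrite card_ord.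
set a := #|_|; set b := #|_|; move: rD; rewrite -/b; lia.
Qed.

(** The factors are multiplied in reverse order, so that on row vectors the shift
    by the head of [s] is applied last, as in a [foldr] over [s]. *)
Fixpoint shift_prod n (U : 'M[F]_n) (s : seq F) : 'M[F]_n :=
  if s is a :: s' then shift_prod U s' *m (U - a%:M) else 1%:M.

Lemma shift_prod_trig n (U : 'M[F]_n) s : is_trig_mx U ->
  is_trig_mx (shift_prod U s) /\
  (forall i, shift_prod U s i i = \prod_(a <- s) (U i i - a)).
Proof.
move=> tU; elim: s => [|a s [tP dP]] /=.
  by split=> [|i]; rewrite ?scalar_mx_is_trig// big_nil mxE eqxx.
have tUa : is_trig_mx (U - a%:M).
  by rewrite -rmorphN /=; apply: trig_addmx => //; exact: scalar_mx_is_trig.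
have [? dM] := trig_mulmx tP tUa; split=> // i.
by rewrite dM dP big_cons mulrC !mxE eqxx mulr1n.
Qed.

Lemma shift_prod_rank n (U : 'M[F]_n) s : is_trig_mx U ->
  (#|[pred i | U i i \notin s]| <= \rank (shift_prod U s))%N.
Proof.
move=> tU; have [tP dP] := shift_prod_trig s tU.
apply: leq_trans (trig_rank_ge tP); apply: subset_leq_card.
apply/fintype.subsetP => i; rewrite !inE dP prodf_seq_neq0 => Us.
by apply/allP => a aS /=; rewrite subr_eq0; apply: contraNneq Us => ->.
Qed.

(** The Cayley-Hamilton theorem for triangular matrices. *)
Lemma shift_prod_diag n (U : 'M[F]_n) : is_trig_mx U ->
  shift_prod U [seq U i i | i <- enum 'I_n] = 0.
Proof.
case: n U => [|n] U tU; first by apply/matrixP => -[].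
rewrite -(Cayley_Hamilton U) char_poly_trig// -big_enum /= rmorph_prod /=.
elim: (enum _) => [|i s IH]; rewrite ?big_nil// big_cons /= IH.
rewrite rmorphB /= horner_mx_X horner_mx_C.
set A := _ - _; set B := \prod_(_ <- _) _; rewrite -[_ *m _]/(B * A).
have comm (p q : {poly F}) : GRing.comm (horner_mx U p) (horner_mx U q).
  by rewrite /GRing.comm -!rmorphM mulrC.
rewrite /A /B -rmorph_prod.
rewrite (_ : U - _ = horner_mx U ('X - (U i i)%:P)); first exact: comm.
by rewrite rmorphB /= horner_mx_X horner_mx_C.
Qed.

(** Multiplying a relation [u *m V = 0] between eigenvectors by the powers of
    [A] turns it into [W *m V = 0], where [W] is a Vandermonde matrix times
    [diag_mx u]. *)
Lemma trig_distinct_diagonalizable n (A : 'M[F]_n) : is_trig_mx A ->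
  injective (fun i => A i i) ->
  exists2 V, V \in unitmx & V *m A = diag_mx (\row_i A i i) *m V.
Proof.
move=> tA injA; pose d : 'rV[F]_n := \row_i A i i.
have ev i : exists v : 'rV[F]_n, v *m A = d 0 i *: v /\ v != 0.
  have : eigenvalue A (d 0 i).
    rewrite eigenvalue_root_char char_poly_trig// /root horner_prod.
    by rewrite (bigD1 i)//= hornerXsubC mxE subrr mul0r.
  by case/eigenvalueP => v; exists v.
have [v vP] := choice ev.
pose V := \matrix_i v i.
have VA : V *m A = diag_mx d *m V.
  apply/row_matrixP => i; rewrite row_mul rowK (vP i).1.
  by rewrite row_mul row_diag_mx -scalemxAl -rowE rowK.
exists V => //; rewrite -row_free_unit -kermx_eq0.
apply/eqP/row_matrixP => k; rewrite row0.
set u := row k _; have uV : u *m V = 0 by rewrite -row_mul mulmx_ker row0.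
have uk j : (\row_i (u 0 i * d 0 i ^+ j)) *m V = 0.
  elim: j => [|j IH].
    by rewrite -[RHS]uV; congr (_ *m _); apply/rowP => i; rewrite mxE expr0 mulr1.
  rewrite (_ : \row_i _ = (\row_i (u 0 i * d 0 i ^+ j)) *m diag_mx d).
    by rewrite -mulmxA -VA mulmxA IH mul0mx.
  by apply/rowP => i; rewrite mul_mx_diag !mxE exprSr mulrA.
pose W := Vandermonde n d *m diag_mx u.
have WV : W *m V = 0.
  apply/row_matrixP => j; rewrite row0 -[RHS](uk j) row_mul; congr (_ *m _).
  by apply/rowP => i; rewrite /W mul_mx_diag !mxE mulrC.
have : diag_mx u *m V = 0.
  have Wu : Vandermonde n d \in unitmx.
    rewrite unitmxE det_Vandermonde unitfE prodf_seq_neq0; apply/allP => i _ /=.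
    rewrite prodf_seq_neq0; apply/allP => j _ /=; apply/implyP => ij.
    rewrite subr_eq0 !mxE; apply/eqP => /injA ji.
    by rewrite ji ltnn in ij.
  by rewrite -[LHS](mulKmx Wu) [X in invmx _ *m X]mulmxA WV mulmx0.
move=> uV0; apply/rowP => i; have := congr1 (row i) uV0.
rewrite row0 row_mul row_diag_mx -scalemxAl -rowE rowK => /eqP.
by rewrite scaler_eq0 (negbTE (vP i).2) orbF => /eqP ->; rewrite mxE.
Qed.

End Triangular.

(** * Pairing values with their negatives *)

Section NegationPairing.
Context (C : numDomainType) (I : finType) (d : I -> C).

(** Remove pairs [i], [j] with [d j = - d i] one after the other; when none is
    left, all values are zero and at most one index remains. *)
Lemma negation_pairing :
  (forall c, #|[pred i | d i == c]| = #|[pred i | d i == - c]|) ->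
  exists p : I -> I, [/\ involutive p, forall i, d (p i) = - d i &
    forall i j, p i = i -> p j = j -> i = j].
Proof.
move=> dS.
suff H (A : pred I) :
    (forall c, #|[pred i | A i & d i == c]| = #|[pred i | A i & d i == - c]|) ->
    exists p : I -> I, [/\ involutive p, forall i, A i -> d (p i) = - d i,
      forall i, ~~ A i -> p i = i &
      forall i j, A i -> A j -> p i = i -> p j = j -> i = j].
  have [c|p [pp dp _ fp]] := H predT; first exact: (dS c).
  by exists p; split=> // [i|i j]; [exact: dp|exact: fp].
have [m] := ubnP #|A|; elim: m A => // m IH A Am AS.
have [/existsP[i /existsP[j /and4P[Ai Aj ij /eqP dij]]]|noij] :=
    boolP [exists i, exists j, [&& A i, A j, i != j & d j == - d i]].
  pose B := [pred k | [&& A k, k != i & k != j]].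
  have cardB (P : pred I) : #|[pred k | A k & P k]| =
      (#|[pred k | B k & P k]| + P i + P j)%N.
    rewrite (cardD1 i) (cardD1 j) !inE Ai Aj /= [j == i]eq_sym ij /=.
    rewrite (@eq_card _ _ [pred k | B k & P k]); first by rewrite addnA addnC -[RHS]addnA.
    by move=> k; rewrite !inE; case: (k == i); case: (k == j); case: (A k).
  have [||p [pp dp Bp fp]] := IH B.
  - rewrite -ltnS; apply: leq_trans Am; rewrite ltnS (cardD1 i A) [i \in A]Ai add1n ltnS.
    apply: subset_leq_card; apply/fintype.subsetP => k; rewrite !inE.
    by case/and3P => Ak -> _.
  - move=> c; have := AS c; rewrite !cardB dij.
    by rewrite eqr_opp eqr_oppLR addnAC => /addIn/addIn.
  have pi : p i = i by apply: Bp; rewrite inE eqxx andbF.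
  have pj : p j = j by apply: Bp; rewrite inE eqxx !andbF.
  (* Extend [p] by exchanging [i] and [j]. *)
  pose q k := if k == i then j else if k == j then i else p k.
  have pni k : k != i -> p k != i by apply: contra_neq => pk; rewrite -(pp k) pk.
  have pnj k : k != j -> p k != j by apply: contra_neq => pk; rewrite -(pp k) pk.
  exists q; split.
  - move=> k; rewrite /q; have [->|ki] := eqVneq k i.
      by rewrite eq_sym (negbTE ij) eqxx.
    have [->|kj] := eqVneq k j; first by rewrite eqxx.
    by rewrite (negbTE (pni _ ki)) (negbTE (pnj _ kj)) pp.
  - move=> k Ak; rewrite /q; have [->//|ki] := eqVneq k i.
    have [->|kj] := eqVneq k j; first by rewrite dij opprK.
    by apply: dp; rewrite inE Ak ki kj.
  - move=> k nAk; rewrite /q; have [ki|ki] := eqVneq k i.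
      by rewrite ki Ai in nAk.
    have [kj|kj] := eqVneq k j; first by rewrite kj Aj in nAk.
    by apply: Bp; rewrite inE (negbTE nAk).
  - move=> k l Ak Al; rewrite /q; have [->|ki] := eqVneq k i.
      by move=> ji; rewrite ji eqxx in ij.
    have [->|kj] := eqVneq k j; first by move=> ji; rewrite ji eqxx in ij.
    have [->|li] := eqVneq l i; first by move=> _ ji; rewrite ji eqxx in ij.
    have [->|lj] := eqVneq l j; first by move=> _ ji; rewrite ji eqxx in ij.
    by apply: fp; rewrite inE ?Ak ?Al ?ki ?kj ?li ?lj.
have noA i j : A i -> A j -> d j = - d i -> i = j.
  move=> Ai Aj dij; apply/eqP; apply: contraNT noij => ij.
  by apply/existsP; exists i; apply/existsP; exists j; rewrite Ai Aj ij dij eqxx.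
have d0 i : A i -> d i = 0.
  move=> Ai; have : (0 < #|[pred k | A k & d k == - d i]|)%N.
    by rewrite -AS; apply/card_gt0P; exists i; rewrite inE Ai eqxx.
  case/card_gt0P => j; rewrite inE => /andP[Aj /eqP dij].
  have E := noA _ _ Ai Aj dij; move: dij; rewrite -E => /eqP.
  by rewrite -addr_eq0 -mulr2n mulrn_eq0 => /eqP.
exists id; split=> // [i Ai|i j Ai Aj _ _]; first by rewrite d0 ?oppr0.
by apply: noA => //; rewrite !d0 ?oppr0.
Qed.

End NegationPairing.

(** * Commutators of idempotent matrices *)

Section CommutatorOfIdempotents.
Context (C : numClosedFieldType) (n : nat).
Implicit Types A E F : 'M[C]_n.

Definition mx_idempotent_commutator A := exists E F,
  [/\ E *m E = E, F *m F = F & A = E *m F - F *m E].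

Lemma idempotent_of_involution (X : 'M[C]_n) : X *m X = 1%:M ->
  (2^-1 *: (1%:M + X)) *m (2^-1 *: (1%:M + X)) = 2^-1 *: (1%:M + X).
Proof.
move=> XX; rewrite -scalemxAl -scalemxAr mulmxDl mul1mx mulmxDr mulmx1 XX.
rewrite [X + _]addrC; congr (_ *: _); rewrite scalerDr -scalerDl.
by rewrite (_ : 2^-1 + 2^-1 = 1) ?scale1r//; field.
Qed.

(** [X] permutes the basis by [p], and [Y] does so with the weights [y i], which
    satisfy [y i * y (p i) = 1] and [y (p i) - y i = 4 * d i]. *)
Lemma diag_idempotent_commutator (d : 'I_n -> C) (p : 'I_n -> 'I_n) :
  involutive p -> (forall i, d (p i) = - d i) ->
  mx_idempotent_commutator (diag_mx (\row_i d i)).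
Proof.
move=> pp dp.
pose y i := sqrtC (4 * d i ^+ 2 + 1) - 2 * d i.
have yp i : y (p i) = sqrtC (4 * d i ^+ 2 + 1) + 2 * d i.
  by rewrite /y dp sqrrN mulrN opprK.
have yy i : y i * y (p i) = 1.
  by rewrite yp /y -subr_sqr sqrtCK; ring.
pose X : 'M[C]_n := \matrix_(i, j) (p i == j)%:R.
pose Y : 'M[C]_n := \matrix_(i, j) (y i * (p i == j)%:R).
have mulX (A : 'M[C]_n) i j : (X *m A) i j = A (p i) j.
  rewrite mxE (bigD1 (p i))//= mxE eqxx mul1r big1 ?addr0// => k kp.
  by rewrite mxE eq_sym (negbTE kp) mul0r.
have mulY (A : 'M[C]_n) i j : (Y *m A) i j = y i * A (p i) j.
  rewrite mxE (bigD1 (p i))//= mxE eqxx mulr1 big1 ?addr0// => k kp.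
  by rewrite mxE eq_sym (negbTE kp) mulr0 mul0r.
have XX : X *m X = 1%:M by apply/matrixP => i j; rewrite mulX !mxE pp.
have YY : Y *m Y = 1%:M.
  by apply/matrixP => i j; rewrite mulY !mxE pp mulrA yy mul1r.
exists (2^-1 *: (1%:M + X)), (2^-1 *: (1%:M + Y)).
split; [exact: idempotent_of_involution|exact: idempotent_of_involution|].
apply/matrixP => i j.
rewrite -!scalemxAl -!scalemxAr !mulmxDl !mul1mx !mulmxDr !mulmx1.
move: (mulX Y i j) (mulY X i j).
set XY := X *m Y; set YX := Y *m X; rewrite !mxE pp => -> ->.
by rewrite yp /y; case: (i == j); rewrite ?mulr1n ?mulr0n; field.
Qed.

Lemma mx_idempotent_commutator_conj (V A B : 'M[C]_n) : V \in unitmx ->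
  V *m A = B *m V -> mx_idempotent_commutator B -> mx_idempotent_commutator A.
Proof.
move=> Vu VA [E [F [EE FF BE]]].
have M (P Q : 'M[C]_n) : (invmx V *m P *m V) *m (invmx V *m Q *m V) =
    invmx V *m (P *m Q) *m V.
  by rewrite !mulmxA mulmxK.
exists (invmx V *m E *m V), (invmx V *m F *m V); rewrite !M EE FF; split=> //.
by rewrite -mulmxBl -mulmxBr -BE -mulmxA -VA mulKmx.
Qed.

(** The involution [X = 2 E - 1] satisfies [X *m A *m X = - A], because
    [E *m A + A *m E = A]. *)
Lemma idempotent_commutator_det A z : mx_idempotent_commutator A ->
  \det (z%:M - A) = (-1) ^+ n * \det ((- z)%:M - A).
Proof.
move=> [E [F [EE FF AE]]].
have [X defX] : {X | X = E + E - 1%:M} by exists (E + E - 1%:M).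
have XX : X *m X = 1%:M.
  rewrite defX mulmxBr mulmx1 mulmxDr !mulmxBl !mul1mx !mulmxDl !EE.
  by apply/matrixP => i j; rewrite !mxE; ring.
have XAX : X *m A = - (A *m X).
  have EA : E *m A = E *m F - E *m F *m E by rewrite AE mulmxBr !mulmxA EE.
  have AE' : A *m E = E *m F *m E - F *m E by rewrite AE mulmxBl -(mulmxA F E E) EE.
  rewrite defX mulmxBl mulmxDl mul1mx mulmxBr mulmxDr mulmx1 EA AE' AE.
  by apply/matrixP => i j; rewrite !mxE; ring.
have dX : \det X * \det X = 1 by rewrite -det_mulmx XX det1.
have -> : (- z)%:M - A = - (z%:M + A) by rewrite opprD rmorphN.
rewrite -[- (z%:M + A)]scaleN1r detZ mulrA -exprMn mulrNN mulr1 expr1n mul1r.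
rewrite -[LHS]mul1r -dX mulrAC -!det_mulmx; congr (\det _).
have XB := mulmxBr X z%:M A; rewrite XB XAX opprK mulmxDl -(mulmxA A) XX mulmx1.
by rewrite scalar_mxC -mulmxA XX mulmx1.
Qed.

End CommutatorOfIdempotents.

(** * Limits and perturbations of symmetric spectra *)

Section DetContinuity.
Context (K : numFieldType).

Lemma det_shift_continuous n (z : K) :
  continuous (fun N : 'M[K]_n => \det (z%:M - N)).
Proof.
have cM i j : continuous (fun N : 'M[K]_n => (z%:M - N) i j).
  rewrite (_ : (fun N : 'M[K]_n => _) = (fun N : 'M[K]_n => (z%:M : 'M[K]_n) i j - N i j)).
    by move=> M; exact: (cvgB (cvg_cst _) (@coord_continuous K n n i j M)).
  by apply/funext => N; rewrite mxE [X in _ + X]mxE.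
rewrite /determinant; apply: continuous_big; first exact: add_continuous.
move=> s _.
have cp : continuous (fun N : 'M[K]_n => \prod_i (z%:M - N) i (s i)).
  by apply: continuous_big => [|i _]; [exact: mul_continuous|exact: cM].
by move=> M; exact: (cvgM (cvg_cst _) (cp M)).
Qed.

(** Both sides are polynomials in the entries of the matrix, so that the equality
    passes to limits. *)
Lemma det_symmetric_limit n (M : 'M[K]_n) z :
  (forall e : K, 0 < e -> exists2 N : 'M[K]_n,
     \det (z%:M - N) = (-1) ^+ n * \det ((- z)%:M - N) &
     forall i j, `|M i j - N i j| < e) ->
  \det (z%:M - M) = (-1) ^+ n * \det ((- z)%:M - M).
Proof.
move=> MN; apply/eqP; rewrite -subr_eq0; apply/negP => /negP h0.
pose h (N : 'M[K]_n) := \det (z%:M - N) - (-1) ^+ n * \det ((- z)%:M - N).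
have ch : continuous (h : 'M[K]_n -> K).
  move=> N; have c1 := @det_shift_continuous n z N.
  have c2 := @det_shift_continuous n (- z) N.
  exact: (cvgB c1 (cvgM (cvg_cst _) c2)).
have n0 : nbhs (h M) [set x : K | x != 0].
  apply/nbhs_ballP; exists `|h M|; first by rewrite /= normr_gt0.
  move=> y; rewrite -ball_normE /= => hy.
  by apply: contraTneq hy => ->; rewrite subr0 ltxx.
have := ch M _ n0.
case/nbhs_ballP => e /= e0 eM.
have [N hN MNe] := MN e e0.
suff : h N != 0 by rewrite /h hN subrr eqxx.
by apply: eM; split => // i j; exact: MNe.
Qed.

End DetContinuity.

Section SymmetricSpectrum.
Context (R : realType).
Local Notation C := R[i].

(** A fixed point of [p] has [a i = 0] and remains 0 under any perturbation of [a]
    that preserves the symmetry; hence there may be only one if the perturbed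
    values are to be distinct. *)
Definition paired n (a : 'I_n -> C) (p : 'I_n -> 'I_n) :=
  [/\ involutive p, forall i, a (p i) = - a i &
      forall i j, p i = i -> p j = j -> i = j].

(** The characteristic polynomial has the same roots as its reflection, with the
    same multiplicities. *)
Lemma trig_det_symmetric_paired n (U : 'M[C]_n) : is_trig_mx U ->
  (forall z, \det (z%:M - U) = (-1) ^+ n * \det ((- z)%:M - U)) ->
  exists p, paired (fun i => U i i) p.
Proof.
move=> tU detU.
have detE z : \det (z%:M - U) = \prod_(i < n) (z - U i i).
  rewrite det_trig; first by apply: eq_bigr => i _; rewrite !mxE eqxx mulr1n.
  rewrite -[- U]scaleN1r; apply: trig_addmx; first exact: scalar_mx_is_trig.
  by apply/is_trig_mxP => i j ij; rewrite mxE (is_trig_mxP tU)// mulr0.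
have polyE :
    \prod_(i < n) ('X - (U i i)%:P) = \prod_(i < n) ('X - (- U i i)%:P).
  set P := LHS; set Q := RHS.
  apply/eqP; rewrite -subr_eq0; apply/negPn/negP => PQ.
  have rt z : root (P - Q) z.
    rewrite /root !hornerE !horner_prod subr_eq0; apply/eqP.
    under eq_bigr do rewrite hornerXsubC.
    under [RHS]eq_bigr do rewrite hornerXsubC opprK.
    rewrite -detE detU detE -[n in (-1) ^+ n]card_ord -prodr_const -big_split.
    by apply: eq_bigr => i _ /=; rewrite mulN1r opprB opprK addrC.
  (* A nonzero polynomial vanishing everywhere would have too many roots. *)
  have := max_poly_roots PQ (rs := [seq k%:R | k <- iota 0 (size (P - Q))]).
  rewrite size_map size_iota ltnn; case/(_ _ _)/implyP => //.
    by apply/allP => x _; exact: rt.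
  by rewrite map_inj_uniq ?iota_uniq// => k l /eqP; rewrite eqr_nat => /eqP.
apply: negation_pairing => c.
have cE (a : 'I_n -> C) x :
    #|[pred i | a i == x]| = mup x (\prod_(i < n) ('X - (a i)%:P)).
  rewrite -(big_map a xpredT (fun y => 'X - y%:P)) mu_prod_XsubC count_map.
  by rewrite -sum1_count -sum1_card; apply: eq_bigl => i; rewrite inE.
rewrite cE polyE -cE; apply: eq_card => i.
by rewrite !inE eqr_oppLR.
Qed.

Lemma avoid_finite (s : seq R) (e : R) : 0 < e ->
  exists t : R, [/\ 0 < t, t < e & t \notin s].
Proof.
elim: s e => [|x s IH] e e0.
  by exists (e / 2); split; rewrite ?divr_gt0 ?ltr_pdivrMr ?ltr_pMr ?ltr1n.
have [x0|x0] := ltP 0 x.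
  have [|t [t0 tx ts]] := IH (Num.min e x); first by rewrite lt_min e0 x0.
  move: tx; rewrite lt_min => /andP[te tx].
  by exists t; split => //; rewrite in_cons negb_or (lt_eqF tx).
have [t [t0 te ts]] := IH e e0.
by exists t; split => //; rewrite in_cons negb_or (gt_eqF (le_lt_trans x0 t0)).
Qed.

(** The weight [w] is injective and odd under [p], so that for small generic [t]
    the perturbed matrix has distinct diagonal entries, still paired by [p]. *)
Lemma paired_perturbation n (U : 'M[C]_n) p : is_trig_mx U ->
  paired (fun i => U i i) p ->
  exists W : 'M[C]_n, forall e : R, 0 < e -> exists t : R,
    [/\ 0 < t, t < e & mx_idempotent_commutator (U + t%:C *: W)].
Proof.
move=> tU [pp Up fp].
pose w (i : 'I_n) : C := if (i < p i)%N then i.+1%:R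
  else if (p i < i)%N then - (p i).+1%:R else 0.
have wp i : w (p i) = - w i.
  by rewrite /w pp; case: ltngtP => _; rewrite ?opprK ?oppr0.
have wI : injective w.
  move=> i j; rewrite /w.
  case: (ltngtP i (p i)) => [_|_|/val_inj/esym pi];
  case: (ltngtP j (p j)) => [_|_|/val_inj/esym pj] /eqP.
  - by rewrite eqr_nat eqSS => /eqP/val_inj.
  - by rewrite -subr_eq0 opprK -natrD pnatr_eq0.
  - by rewrite pnatr_eq0.
  - by rewrite eq_sym -subr_eq0 opprK -natrD pnatr_eq0.
  - by rewrite eqr_opp eqr_nat eqSS => /eqP/val_inj/(can_inj pp).
  - by rewrite oppr_eq0 pnatr_eq0.
  - by rewrite eq_sym pnatr_eq0.
  - by rewrite eq_sym oppr_eq0 pnatr_eq0.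
  - by move=> _; exact: fp.
exists (diag_mx (\row_i w i)) => e e0.
(* The values of [t] for which two diagonal entries coincide. *)
pose bad := [seq complex.Re ((U ij.2 ij.2 - U ij.1 ij.1) / (w ij.1 - w ij.2)) |
  ij <- enum {: 'I_n * 'I_n}].
have [t [t0 te tbad]] := avoid_finite bad e0.
exists t; split => //.
set D := t%:C *: _.
have DE i j : D i j = t%:C * w i *+ (i == j).
  by rewrite !mxE -mulrnAr.
have tUD : is_trig_mx (U + D).
  apply: trig_addmx => //; apply/is_trig_mxP => i j ij.
  by rewrite DE -val_eqE ltn_eqF// mulr0n.
pose d i := U i i + t%:C * w i.
have dE i : (U + D) i i = d i by rewrite mxE DE eqxx mulr1n.
have dI : injective (fun i => (U + D) i i).
  move=> i j; rewrite !dE /d => dij; apply/eqP; apply: contraNT tbad => ij.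
  apply/mapP; exists (i, j); rewrite ?mem_enum//=.
  have wij : w i - w j != 0 by rewrite subr_eq0 (inj_eq wI).
  suff -> : U j j - U i i = t%:C * (w i - w j) by rewrite mulfK.
  apply/eqP; rewrite -subr_eq0.
  have -> : U j j - U i i - t%:C * (w i - w j) =
      (U j j + t%:C * w j) - (U i i + t%:C * w i) by ring.
  by rewrite dij subrr.
have [V Vu VA] := trig_distinct_diagonalizable tUD dI.
apply: mx_idempotent_commutator_conj Vu VA _.
rewrite (_ : \row_i _ = \row_i d i); last by apply/rowP => i; rewrite [LHS]mxE dE [RHS]mxE.
by apply: (diag_idempotent_commutator pp) => i; rewrite /d Up wp mulrN opprD.
Qed.

End SymmetricSpectrum.

(** * Coordinates *)

Import VectorInternalTheory.

Section Coordinates.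
Context (K : fieldType) (V : vectType K) (P : 'M[K]_(dim V)).
Hypothesis Pu : P \in unitmx.
Implicit Types (S T : 'End(V)) (x y : V) (A B : 'M[K]_(dim V)).

(** An arbitrary invertible [P] is allowed in order to study the same operator in
    triangular and in orthonormal coordinates. *)
Definition coords x : 'rV[K]_(dim V) := v2r x *m P.
Definition uncoords (u : 'rV[K]_(dim V)) : V := r2v (u *m invmx P).
Definition opmx T : 'M[K]_(dim V) := invmx P *m f2mx T *m P.
Definition mxop A : 'End(V) := Hom (P *m A *m invmx P).

Lemma coordsK : cancel coords uncoords.
Proof. by move=> x; rewrite /uncoords /coords mulmxK// v2rK. Qed.

Lemma uncoordsK : cancel uncoords coords.
Proof. by move=> u; rewrite /uncoords /coords r2vK mulmxKV. Qed.

Lemma coordsD x y : coords (x + y) = coords x + coords y.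
Proof. by rewrite /coords raddfD mulmxDl. Qed.

Lemma coordsZ a x : coords (a *: x) = a *: coords x.
Proof. by rewrite /coords linearZ scalemxAl. Qed.

Lemma coordsB x y : coords (x - y) = coords x - coords y.
Proof. by rewrite /coords raddfB mulmxBl. Qed.

Lemma coords0 : coords 0 = 0.
Proof. by rewrite /coords raddf0 mul0mx. Qed.

Lemma coords_lfun T x : coords (T x) = coords x *m opmx T.
Proof.
by rewrite /coords /opmx unlock /= r2vK /mulmxr !mulmxA mulmxK.
Qed.

Lemma opmx_ext T A : (forall x, coords (T x) = coords x *m A) -> opmx T = A.
Proof.
move=> TA; apply/row_matrixP => i.
by rewrite !rowE -[delta_mx 0 i]uncoordsK -TA -coords_lfun.
Qed.

Lemma opmxK : cancel opmx mxop.
Proof.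
move=> T; apply/val_inj => /=; rewrite /opmx !mulmxA mulmxV// mul1mx.
by rewrite mulmxK.
Qed.

Lemma mxopK : cancel mxop opmx.
Proof. by move=> A; rewrite /opmx /= !mulmxA mulVmx// mul1mx mulmxKV. Qed.

Lemma opmx_surj A : exists T, opmx T = A.
Proof. by exists (mxop A); exact: mxopK. Qed.

Lemma opmx_inj : injective opmx. Proof. exact: can_inj opmxK. Qed.

Lemma opmx_comp S T : opmx (S \o T)%VF = opmx T *m opmx S.
Proof. by apply: opmx_ext => x; rewrite comp_lfunE !coords_lfun mulmxA. Qed.

Lemma opmxD S T : opmx (S + T) = opmx S + opmx T.
Proof. by apply: opmx_ext => x; rewrite add_lfunE coordsD !coords_lfun mulmxDr. Qed.

Lemma opmxZ a T : opmx (a *: T) = a *: opmx T.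
Proof. by apply: opmx_ext => x; rewrite scale_lfunE coordsZ coords_lfun scalemxAr. Qed.

Lemma opmxN T : opmx (- T) = - opmx T.
Proof. by rewrite -scaleN1r opmxZ scaleN1r. Qed.

Lemma opmxB S T : opmx (S - T) = opmx S - opmx T.
Proof. by rewrite opmxD opmxN. Qed.

Lemma opmx1 : opmx \1%VF = 1%:M.
Proof. by apply: opmx_ext => x; rewrite id_lfunE mulmx1. Qed.

Lemma dim_limg T : \dim (limg T) = \rank (opmx T).
Proof.
have -> : \rank (opmx T) = \rank (f2mx T).
  rewrite /opmx mxrankMfree ?row_free_unit// (eqmxMfull (f2mx T))//.
  by rewrite row_full_unit unitmx_inv.
rewrite unlock /dimv /= mx2vsK (eqmxMfull (f2mx T))//.
by rewrite -sub1mx mx2vsK submx1.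
Qed.

Lemma dim_lker T : \dim (lker T) = (dim V - \rank (opmx T))%N.
Proof.
have := limg_ker_dim T fullv; rewrite dim_limg dimvf.
rewrite (_ : (fullv :&: lker T)%VS = lker T); last exact/capv_idPr/subvf.
by move=> E; rewrite -[X in (X - _)%N]E addnK.
Qed.

End Coordinates.

Section HilbertCoordinates.
Context (R : realType) (H : vectType R[i]) (dot : {dot H for Num.conj}).
Local Open Scope sesquilinear_scope.
Local Notation C := R[i].

(** An orthonormal basis: if the Gram matrix is [Q^t* *m diag_mx d *m Q] with [Q]
    unitary, then [Q^t*] times the square root of [diag_mx d] works. *)
Lemma orthonormal_coords : exists2 P : 'M[C]_(dim H), P \in unitmx &
  forall x y, dot x y = (coords P x *m (coords P y)^t*) 0 0.
Proof.
pose G : 'M[C]_(dim H) :=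
  \matrix_(i, j) dot (r2v (delta_mx 0 i)) (r2v (delta_mx 0 j)).
have dotE (u v : 'rV[C]_(dim H)) : dot (r2v u) (r2v v) = (u *m G *m v^t*) 0 0.
  transitivity (\sum_j \sum_i u 0 i * G i j * (v 0 j)^*).
    rewrite {1}[u]row_sum_delta {1}[v]row_sum_delta !linear_sum.
    apply: eq_bigr => j _.
    rewrite /= linear_sumlz; apply: eq_bigr => i _.
    by rewrite !linearZ /= linearZl_LR !mxE mulrC.
  rewrite [RHS]mxE; apply: eq_bigr => j _.
  by rewrite !mxE mulr_suml.
have Gh : G \is hermsymmx.
  apply/is_hermitianmxP; rewrite expr0 scale1r; apply/matrixP => i j.
  by rewrite !mxE hermC expr0 mul1r.
have /hermitian_normalmx /orthomx_spectralP := Gh.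
set Q := spectralmx G; set d := spectral_diag G => GE.
have Qu : Q \is unitarymx := spectral_unitarymx G.
have Qi := invmx_unitary Qu.
have Qunit := unitarymx_unit Qu.
have d0 i : 0 < d 0 i.
  have : 0 < dot (r2v (row i Q)) (r2v (row i Q)).
    apply: neq0_dnorm_gt0; rewrite -(inj_eq (@v2r_inj _ _)) r2vK raddf0.
    apply: contraTneq Qunit => Q0; rewrite -row_free_unit; apply/row_freePn.
    by exists i; rewrite Q0 sub0mx.
  have QGQ : Q *m G *m Q^t* = diag_mx d.
    rewrite GE Qi !mulmxA (unitarymxP Qu) mul1mx.
    by rewrite -mulmxA (unitarymxP Qu) mulmx1.
  rewrite dotE; suff -> : (row i Q *m G *m (row i Q)^t*) 0 0 = d 0 i by [].
  have -> : d 0 i = (Q *m G *m Q^t*) i i by rewrite QGQ !mxE eqxx mulr1n.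
  rewrite -row_mul mxE [RHS]mxE; apply: eq_bigr => k _.
  by rewrite [row i _ 0 k]mxE; congr (_ * _); rewrite !mxE.
pose r := \row_i sqrtC (d 0 i).
have rK : diag_mx r *m (diag_mx r)^t* = diag_mx d.
  rewrite tr_diag_mx map_diag_mx mulmx_diag; congr diag_mx; apply/rowP => i.
  rewrite !mxE /= conj_Creal -?expr2 ?sqrtCK//.
  by apply: ger0_real; rewrite sqrtC_ge0 ltW.
exists (Q^t* *m diag_mx r).
  rewrite unitmx_mul -Qi unitmx_inv Qunit /= unitmxE det_diag unitfE.
  by apply/prodf_neq0 => i _; rewrite mxE sqrtC_eq0 lt0r_neq0.
have PP : (Q^t* *m diag_mx r) *m (Q^t* *m diag_mx r)^t* = G.
  rewrite trmx_mul map_mxM trmxCK mulmxA -[X in X *m Q]mulmxA [RHS]GE Qi.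
  by congr (_ *m _ *m _); exact: rK.
move=> x y; rewrite -{1}[x]v2rK -{1}[y]v2rK dotE -PP /coords.
rewrite [in RHS]trmx_mul [in RHS]map_mxM !mulmxA.
by congr ((_ *m _) 0 0).
Qed.
End HilbertCoordinates.

(** * Norms, closed ranges and adjoints in orthonormal coordinates *)

Section OrthonormalCoordinates.
Context (R : realType) (H : vectType R[i]) (dot : {dot H for Num.conj}).
Local Open Scope sesquilinear_scope.
Local Notation C := R[i].
Local Notation n := (dim H).
Context (P : 'M[C]_n).
Hypothesis Pu : P \in unitmx.
Hypothesis dotP : forall x y, dot x y = (coords P x *m (coords P y)^t*) 0 0.
Implicit Types (T : 'End(H)) (x y : H).
Local Notation hn := (hilbert_norm dot).

Lemma dot_coords x : dot x x = \sum_k `|coords P x 0 k| ^+ 2.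
Proof.
by rewrite dotP mxE; apply: eq_bigr => k _; rewrite !mxE normCK.
Qed.

Lemma hilbert_norm_ge0 x : 0 <= hn x. Proof. exact: sqrtr_ge0. Qed.

Lemma sqr_hilbert_norm x : (hn x)%:C ^+ 2 = \sum_k `|coords P x 0 k| ^+ 2.
Proof.
have d0 : 0 <= dot x x.
  by rewrite dot_coords; apply: sumr_ge0 => k _; rewrite exprn_ge0.
rewrite -rmorphXn /= sqr_sqrtr.
  by rewrite RRe_real ?ger0_real ?dot_coords// -dot_coords.
by rewrite -lecR RRe_real// ger0_real.
Qed.

Lemma coords_le_hilbert_norm x k : `|coords P x 0 k| <= (hn x)%:C.
Proof.
rewrite -(@ler_pXn2r _ 2) ?nnegrE ?normr_ge0 ?ler0c ?hilbert_norm_ge0//.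
rewrite sqr_hilbert_norm (bigD1 k)//= lerDl.
by apply: sumr_ge0 => i _; rewrite exprn_ge0.
Qed.

Lemma hilbert_norm_le_coords x : (hn x)%:C <= \sum_k `|coords P x 0 k|.
Proof.
have S0 : 0 <= \sum_k `|coords P x 0 k| by apply: sumr_ge0.
rewrite -(@ler_pXn2r _ 2) ?nnegrE ?normr_ge0 ?ler0c ?hilbert_norm_ge0//.
rewrite sqr_hilbert_norm expr2 mulr_suml; apply: ler_sum => k _.
rewrite expr2 ler_wpM2l// (bigD1 k)//= lerDl.
by apply: sumr_ge0.
Qed.

Lemma hilbert_norm_lfun_bounded T : exists2 M : R, 0 <= M &
  forall x, hn (T x) <= M * hn x.
Proof.
pose B : C := \sum_j \sum_k `|opmx P T k j|.
have B0 : 0 <= B by apply: sumr_ge0 => j _; apply: sumr_ge0.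
have BE : (complex.Re B)%:C = B by rewrite RRe_real// ger0_real.
exists (complex.Re B); first by rewrite -lecR BE.
move=> x; rewrite -lecR rmorphM /= BE.
apply: le_trans (hilbert_norm_le_coords _) _.
rewrite (coords_lfun Pu) mulr_suml; apply: ler_sum => j _.
rewrite mxE mulr_suml; apply: le_trans (ler_norm_sum _ _ _) _.
apply: ler_sum => k _; rewrite normrM mulrC ler_wpM2l//.
exact: coords_le_hilbert_norm.
Qed.

Lemma hilbert_norm_le_opnorm T x : hn x <= 1 -> hn (T x) <= opnorm dot T.
Proof.
move=> x1; have [M M0 TM] := hilbert_norm_lfun_bounded T.
apply: ub_le_sup; last by exists x.
exists M.
move=> _ [y /= y1 <-]; apply: le_trans (TM y) _.
by rewrite -[leRHS]mulr1 ler_wpM2l.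
Qed.

Lemma opmx_le_opnorm T i j : `|opmx P T i j| <= (opnorm dot T)%:C.
Proof.
pose e := uncoords P (delta_mx 0 i).
have ce : coords P e = delta_mx 0 i by rewrite uncoordsK.
have e1 : hn e <= 1.
  rewrite -lecR -(@ler_pXn2r _ 2) ?nnegrE ?normr_ge0 ?ler0c ?hilbert_norm_ge0 ?ler01//.
  rewrite sqr_hilbert_norm ce (bigD1 i)//= big1 => [|k ki].
    by rewrite mxE !eqxx normr1 addr0 rmorph1.
  by rewrite mxE (negbTE ki) andbF normr0 expr0n.
apply: le_trans (_ : (hn (T e))%:C <= _); last by rewrite lecR hilbert_norm_le_opnorm.
apply: le_trans (coords_le_hilbert_norm _ j).
by rewrite (coords_lfun Pu) ce -rowE [X in _ <= `|X|]mxE.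
Qed.

Lemma opnorm_scale_le T : exists2 M : R, 0 <= M &
  forall t : R, 0 <= t -> opnorm dot (t%:C *: T) <= t * M.
Proof.
have [M M0 TM] := hilbert_norm_lfun_bounded T; exists M => // t t0.
apply: ge_sup.
  exists (hn ((t%:C *: T) 0)), 0 => //=.
  rewrite -lecR; apply: le_trans (hilbert_norm_le_coords _) _.
  by rewrite coords0 big1 ?ler01// => k _; rewrite mxE normr0.
move=> _ [x /= x1 <-]; rewrite scale_lfunE.
have -> : hn (t%:C *: T x) = t * hn (T x).
  rewrite /hilbert_norm linearZl_LR linearZr_LR /=.
  rewrite conj_Creal; last by rewrite ger0_real// ler0c.
  rewrite mulrA -rmorphM /= -expr2.
  case: (dot _ _) => a b /=; rewrite mul0r subr0.
  by rewrite sqrtrM ?sqr_ge0// sqrtr_sqr ger0_norm.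
rewrite ler_wpM2l//; apply: le_trans (TM x) _.
by rewrite -[leRHS]mulr1 ler_wpM2l.
Qed.

(** A vector outside the range of [T] is separated from it by a coordinate
    functional vanishing on the range, hence lies at a positive distance. *)
Lemma closed_range_lfun T : closed_range dot T.
Proof.
move=> y yT; have [A defA] : {A | A = opmx P T} by exists (opmx P T).
have yA : (coords P y <= A)%MS.
  rewrite submxE; apply/eqP/rowP => j; rewrite [RHS]mxE.
  pose B : C := \sum_k `|cokermx A k j|.
  have B0 : 0 <= B by apply: sumr_ge0.
  have BE : (complex.Re B)%:C = B by rewrite RRe_real// ger0_real.
  set z := (_ *m _) 0 j.
  have zB (e : R) : 0 < e -> `|z| <= e%:C * B.
    move=> e0; have [x xe] := yT e e0.
    have -> : z = (coords P (y - T x) *m cokermx A) 0 j.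
      rewrite coordsB (coords_lfun Pu) -defA mulmxBl -(mulmxA (coords P x)).
      by rewrite mulmx_coker mulmx0 subr0.
    rewrite mxE mulr_sumr; apply: le_trans (ler_norm_sum _ _ _) _.
    apply: ler_sum => k _; rewrite normrM ler_wpM2r//.
    by apply: le_trans (coords_le_hilbert_norm _ _) _; rewrite lecR ltW.
  have zE : (complex.Re `|z|)%:C = `|z| by rewrite RRe_real.
  apply/eqP; rewrite -normr_le0 -zE lecR; apply/ler_addgt0Pr => e e0.
  have B1 : 0 < complex.Re B + 1 by rewrite ltr_wpDl// -lecR BE.
  have := zB (e / (complex.Re B + 1)) (divr_gt0 e0 B1).
  rewrite -BE -rmorphM -zE lecR add0r => /le_trans; apply.
  by rewrite -mulrA ler_piMr ?(ltW e0)// ler_pdivrMl// mulr1 lerDl ler01.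
have [u uA] := submxP yA.
have -> : y = T (uncoords P u).
  by apply: (can_inj (coordsK Pu)); rewrite (coords_lfun Pu) (uncoordsK Pu) -defA.
exact: memv_img (memvf _).
Qed.

(** The matrix of the adjoint is the conjugate transpose, which has the same
    rank. *)
Lemma dim_lker_adjoint T : \dim (lker (adjoint dot T)) = \dim (lker T).
Proof.
have adjT : forall x y, dot (T x) y = dot x (adjoint dot T y).
  rewrite /adjoint; case: xgetP => [S _ //|/(_ (mxop P ((opmx P T)^t*)))].
  case=> x y; rewrite !dotP !(coords_lfun Pu) (mxopK Pu).
  rewrite [in RHS]trmx_mul [in RHS]map_mxM.
  rewrite trmxCK -mulmxA; congr ((_ *m (_ *m _)) 0 0).
set S := adjoint dot T in adjT *.
have AE : opmx P T = (opmx P S)^t*.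
  apply/matrixP => i j.
  have dr (u : 'rV[C]_n) k : (u *m (delta_mx 0 k)^t*) 0 0 = u 0 k.
    rewrite mxE (bigD1 k)//= big1 => [|l lk]; rewrite !mxE !eqxx.
      by rewrite addr0 rmorph1 mulr1.
    by rewrite (negbTE lk) andbF rmorph0 mulr0.
  have := adjT (uncoords P (delta_mx 0 i)) (uncoords P (delta_mx 0 j)).
  rewrite !dotP !(coords_lfun Pu) !(uncoordsK Pu) dr -!rowE [LHS]mxE => ->.
  by rewrite !mxE.
by rewrite (dim_lker Pu S) (dim_lker Pu T) AE mxrank_map mxrank_tr.
Qed.

End OrthonormalCoordinates.

(** * Partial fractions of the resolvent *)

Section GeneralizedEigenvectors.
Context (R : realType) (H : vectType R[i]) (T : 'End(H)).
Local Notation C := R[i].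
Implicit Types (X Y Z : 'End(H)) (a b z : C) (s : seq C).

Local Notation N a X := (sub_scalar T a \o X)%VF.

(** The generalized eigenvectors considered here are operators [X], on which [T]
    acts by composition. The case of the identity yields expansions of the
    resolvent itself. *)
Definition shift_op s X : 'End(H) := foldr (fun a Y => N a Y) X s.

Lemma shift_op_linear s : linear (shift_op s).
Proof.
move=> k X Y; elim: s => //= a s ->.
by rewrite comp_lfunDr comp_lfunZr.
Qed.

Lemma shift_opD s X Y : shift_op s (X + Y) = shift_op s X + shift_op s Y.
Proof. by have := shift_op_linear s 1 X Y; rewrite !scale1r. Qed.

Lemma shift_op0 s : shift_op s 0 = 0.
Proof. by elim: s => //= a s ->; rewrite comp_lfun0r. Qed.

Lemma shift_opZ s k X : shift_op s (k *: X) = k *: shift_op s X.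
Proof. by have := shift_op_linear s k X 0; rewrite shift_op0 !addr0. Qed.

Lemma shift_op_sum s I (r : seq I) (Q : pred I) (F : I -> 'End(H)) :
  shift_op s (\sum_(i <- r | Q i) F i) = \sum_(i <- r | Q i) shift_op s (F i).
Proof. by apply: (big_morph _ (shift_opD s) (shift_op0 s)). Qed.

Lemma shift_op_cat s t X : shift_op (s ++ t) X = shift_op s (shift_op t X).
Proof. by rewrite /shift_op foldr_cat. Qed.

Lemma sub_scalarC a b :
  (sub_scalar T a \o sub_scalar T b = sub_scalar T b \o sub_scalar T a)%VF.
Proof.
have E c x : sub_scalar T c x = T x - c *: x.
  by rewrite /sub_scalar add_lfunE opp_lfunE scale_lfunE id_lfunE.
apply/lfunP => x; rewrite !comp_lfunE !E !linearB !linearZ /= ?scalerBr.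
rewrite !scalerA [b * a]mulrC.
by rewrite !addrA; congr (_ + _); rewrite addrAC.
Qed.

Lemma shift_opN s a X : shift_op s (N a X) = N a (shift_op s X).
Proof. by elim: s => //= b s ->; rewrite comp_lfunA sub_scalarC -comp_lfunA. Qed.

Lemma shift_opC s t X : shift_op s (shift_op t X) = shift_op t (shift_op s X).
Proof. by elim: t => //= a t IH; rewrite shift_opN IH. Qed.

(** The principal part at [a] of the function [z |-> (z - T)^-1 X], when [X] is
    killed by [(T - a) ^ n]. *)
Definition pole_part a n X z : 'End(H) :=
  \sum_(j <- iota 0 n) (z - a)^-1 ^+ j.+1 *: shift_op (nseq j a) X.

(** A telescoping sum. *)
Lemma pole_partP a n X z : shift_op (nseq n a) X = 0 -> z != a ->
  ((z *: \1 - T) \o pole_part a n X z)%VF = X.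
Proof.
move=> Xn za; have za0 : z - a != 0 by rewrite subr_eq0.
pose f j := (z - a)^-1 ^+ j *: shift_op (nseq j a) X.
have -> : z *: \1%VF - T = (z - a) *: \1%VF - sub_scalar T a.
  by rewrite /sub_scalar scalerBl opprB addrA subrK.
rewrite /pole_part; have := telescope_sumr f (leq0n n).
rewrite (_ : f n = 0); last by rewrite /f Xn scaler0.
rewrite (_ : f 0%N = X); last by rewrite /f expr0 scale1r.
rewrite sub0r => E.
rewrite -[RHS]opprK -E -sumrN.
rewrite (big_morph (comp_lfun _) (comp_lfunDr _) (comp_lfun0r _ _)).
rewrite /index_iota subn0.
apply: eq_bigr => j _.
rewrite comp_lfunDl comp_lfunNl -comp_lfunZl comp_lfun1l opprB -!comp_lfunZr.
by rewrite scalerA exprS mulVKf// /f exprS.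
Qed.

Lemma shift_op_pole_part s a n X z : shift_op s X = 0 ->
  shift_op s (pole_part a n X z) = 0.
Proof.
move=> sX; rewrite shift_op_sum big1// => j _.
by rewrite shift_opZ shift_opC sX shift_op0 scaler0.
Qed.

Inductive gen_span : 'End(H) -> Prop :=
| gen_span0 : gen_span 0
| gen_span_add a n Y X :
    shift_op (nseq n a) Y = 0 -> gen_span X -> gen_span (Y + X).

(** The components of [X] at eigenvalues different from [a] lie in the image of
    [T - a], which is bijective on the corresponding generalized eigenspaces. *)
Lemma gen_span_split a X : gen_span X ->
  exists n Y Z, [/\ shift_op (nseq n a) Y = 0, gen_span Z & X = Y + N a Z].
Proof.
elim=> [|b n Y {}X Yn gX [m [Y' [Z [Y'm gZ ->]]]]].
  by exists 0%N, 0, 0; split; [|exact: gen_span0|rewrite comp_lfun0r addr0].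
have [ba|ba] := eqVneq b a.
  exists (n + m)%N, (Y + Y'), Z; split=> //; last by rewrite addrA.
  rewrite nseqD shift_opD !shift_op_cat Y'm shift_op0 addr0.
  by rewrite shift_opC -ba Yn shift_op0.
exists m, Y', (- pole_part b n Y a + Z); split=> //.
  apply: (@gen_span_add b n) => //; rewrite -scaleN1r shift_opZ.
  by rewrite (shift_op_pole_part _ _ _ Yn) scaler0.
have ab : a != b by rewrite eq_sym.
have YE := pole_partP Yn ab.
rewrite comp_lfunDr addrCA; congr (_ + _).
by rewrite -{1}YE comp_lfunNr -comp_lfunNl /sub_scalar opprB.
Qed.

(** By induction, [(T - a) X] is a sum of generalized eigenvectors. All its
    components but the one at [a] lift to [X], and what remains of [X] is then a
    generalized eigenvector for [a]. *)
Lemma gen_span_shift s X : shift_op s X = 0 -> gen_span X.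
Proof.
elim: s X => [|a s IH] X /=; first by move=> ->; exact: gen_span0.
rewrite -shift_opN => /IH gX.
have [n [Y [Z [Yn gZ XE]]]] := gen_span_split a gX.
rewrite -[X](subrK Z); apply: (@gen_span_add a n.+1) => //.
rewrite -[n.+1]addn1 nseqD.
rewrite shift_op_cat /= comp_lfunDr comp_lfunNr XE.
by rewrite addrK.
Qed.

Lemma resolvent_comp z X : ~ spectrum T z ->
  (resolvent T z \o ((z *: \1 - T) \o X))%VF = X.
Proof.
move=> /contrapT[S [ST TS]]; rewrite /resolvent lker0_compKf//.
apply/lker0P => u v; have -> : z *: \1%VF - T = - sub_scalar T z.
  by rewrite /sub_scalar opprB.
rewrite !opp_lfunE => /oppr_inj /(congr1 S).
by rewrite -!comp_lfunE ST !id_lfunE.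
Qed.

Lemma resolvent_pole_part a n X z : shift_op (nseq n a) X = 0 -> spectrum T a ->
  ~ spectrum T z -> (resolvent T z \o X)%VF = pole_part a n X z.
Proof.
move=> Xn sa sz; have za : z != a by apply/eqP => E; apply: sz; rewrite E.
by rewrite -{1}(pole_partP Xn za) resolvent_comp.
Qed.

Lemma shift_op_not_spectrum a n X : ~ spectrum T a ->
  shift_op (nseq n a) X = 0 -> X = 0.
Proof.
move=> /contrapT[S [ST _]]; elim: n => //= n IH /(congr1 (comp_lfun S)).
by rewrite comp_lfunA ST comp_lfun1l comp_lfun0r.
Qed.

(** Partial fractions of the resolvent: the triple [(a, k, X)] stands for
    [X / (z - a) ^ (k + 1)]. *)
Lemma resolvent_expansion X : gen_span X -> exists L : seq (C * nat * 'End(H)),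
  [/\ forall p, p \in L -> spectrum T p.1.1 /\
        exists n, shift_op (nseq n p.1.1) p.2 = 0,
      forall z, ~ spectrum T z -> (resolvent T z \o X)%VF =
        \sum_(p <- L) (z - p.1.1)^-1 ^+ p.1.2.+1 *: p.2 &
      X = \sum_(p <- L | p.1.2 == 0%N) p.2].
Proof.
elim=> [|a n Y {}X Yn gX [L [Ls Lr LX]]].
  by exists [::]; split=> // [z _|]; rewrite big_nil// comp_lfun0r.
have [sa|nsa] := pselect (spectrum T a); last first.
  by rewrite (shift_op_not_spectrum nsa Yn) add0r; exists L.
exists ([seq (a, j, shift_op (nseq j a) Y) | j <- iota 0 n] ++ L); split.
- move=> p; rewrite mem_cat => /orP[/mapP[j _ ->] /=|]; last exact: Ls.
  by split=> //; exists n; rewrite shift_opC Yn shift_op0.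
- move=> z sz; rewrite comp_lfunDr Lr// big_cat big_map /=.
  by rewrite (resolvent_pole_part Yn).
- rewrite big_cat big_map /= -LX; congr (_ + _).
  case: n Yn => [/= ->|n _] /=; first by rewrite big_nil.
  rewrite big_cons /= big_seq_cond big1 ?addr0// => j.
  by rewrite mem_iota; case: j => [|j] /=; rewrite ?andbF.
Qed.

End GeneralizedEigenvectors.

(** * Dimension of the Riesz spaces *)

Section CauchyDiscs.
Context (R : realType).
Local Notation C := R[i].

Lemma exists_lower_bound (s : seq R) : exists2 r : R, 0 < r &
  forall x, x \in s -> 0 < x -> r < x.
Proof.
elim: s => [|x s [r r0 rs]]; first by exists 1.
exists (if 0 < x then Num.min r (x / 2) else r).
  by case: ifP => // x0; rewrite lt_min r0 divr_gt0.
move=> y; rewrite in_cons => /orP[/eqP ->|ys] y0.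
  by rewrite y0 gt_min ltr_pdivrMr// ltr_pMr// ltr1n orbT.
by case: ifP => _; [rewrite gt_min|]; rewrite rs.
Qed.

Lemma spectral_gap (s : seq C) : exists2 r : R, 0 < r &
  forall z w, z \in s -> w \in s -> z != w -> r%:C < `|z - w|.
Proof.
have [r r0 rs] := exists_lower_bound
  [seq complex.Re `|zw.1 - zw.2| | zw <- [seq (z, w) | z <- s, w <- s]].
have nE (z : C) : (complex.Re `|z|)%:C = `|z| by rewrite RRe_real.
exists r => // z w zs ws zw; rewrite -nE ltcR; apply: rs.
  apply/mapP; exists (z, w) => //; apply/allpairsP; exists (z, w) => //=.
by rewrite -ltcR nE normr_gt0 subr_eq0.
Qed.

Context (H : vectType R[i]) (T : 'End(H)) (sp : seq C).
Hypothesis spP : forall z, spectrum T z <-> z \in sp.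

Lemma cauchy_discs_exist Omega : exists D, cauchy_discs T Omega D.
Proof.
have [r r0 gap] := spectral_gap sp.
pose r2 := r / 2; have r20 : 0 < r2 by rewrite divr_gt0.
have rE : r%:C = r2%:C + r2%:C by rewrite -rmorphD /= -splitr.
have r2r : r2%:C < r%:C by rewrite rE ltrDl -(rmorph0 (real_complex R)) ltcR.
pose D := [seq (z, r2) | z <- undup sp & `[< Omega z >]].
have DP d : d \in D -> [/\ d.1 \in sp, Omega d.1 & d.2 = r2].
  by case/mapP => z; rewrite mem_filter mem_undup => /andP[/asboolP ? ?] ->.
exists D; split.
- split; last by move=> d /DP[_ _ ->].
  rewrite map_inj_uniq; first by rewrite filter_uniq ?undup_uniq.
  by move=> z w [].
- move=> d e /DP[ds _ dr] /DP[es _ er] de z; rewrite dr er => -[zd ze].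
  have dne : d.1 != e.1.
    apply: contraNneq de => E.
    by rewrite [d]surjective_pairing [e]surjective_pairing E dr er.
  have := gap _ _ ds es dne; apply/negP.
  rewrite -real_leNgt ?normr_real ?gtr0_real//; last first.
    by rewrite -(rmorph0 (real_complex R)) ltcR.
  rewrite (_ : d.1 - e.1 = (z - e.1) - (z - d.1)); last by ring.
  by apply: le_trans (ler_normB _ _) _; rewrite rE lerD.
- move=> z /spP zs Oz; exists (z, r2).
    by apply/mapP; exists z; rewrite // mem_filter mem_undup zs asboolT.
  by rewrite subrr normr0 -(rmorph0 (real_complex R)) ltcR.
- move=> z /spP zs nOz d /DP[ds Od ->] zd.
  have zne : z != d.1 by apply: contra_notN nOz => /eqP ->.
  have := gap _ _ zs ds zne.
  by move=> /lt_le_trans/(_ zd)/(lt_trans r2r); rewrite ltxx.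
Qed.

(** A point of the spectrum lies inside exactly one of the discs if it belongs to
    [Omega], and inside none otherwise; it never lies on a circle. *)
Lemma riesz_idempotent_expansion Omega (L : seq (C * nat * 'End(H))) :
  (forall p, p \in L -> spectrum T p.1.1) ->
  (forall z, ~ spectrum T z -> resolvent T z =
     \sum_(p <- L) (z - p.1.1)^-1 ^+ p.1.2.+1 *: p.2) ->
  riesz_idempotent Omega T =
  \sum_(p <- L | (p.1.2 == 0%N) && `[< Omega p.1.1 >]) p.2.
Proof.
move=> Ls Lr; rewrite /riesz_idempotent.
case: xgetP => [D _ [[Duniq D0] Ddisj Din Dout]|]; last first.
  by have [D DT] := cauchy_discs_exist Omega => /(_ D).
have inside z d : spectrum T z -> d \in D -> `|z - d.1| <= d.2%:C ->
    Omega z /\ `|z - d.1| < d.2%:C.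
  move=> sz dD zd; have [Oz|nOz] := pselect (Omega z); last first.
    by have := Dout _ sz nOz _ dD zd.
  split=> //; have [e eD ze] := Din _ sz Oz.
  have [<-//|ed] := eqVneq e d.
  by have := Ddisj _ _ eD dD ed z (conj (ltW ze) zd).
have off z d : spectrum T z -> d \in D -> `|z - d.1| != d.2%:C.
  move=> sz dD; apply/eqP => E.
  by have [|_] := inside _ _ sz dD; rewrite E ?lexx ?ltxx.
pose k0 : C := 2 * pi%:C * 'i.
have k00 : k0 != 0.
  rewrite mulf_neq0 ?neq0Ci// mulf_neq0 ?pnatr_eq0//.
  by rewrite -(rmorph0 (real_complex R)) (inj_eq (@complexI R)) lt0r_neq0 ?pi_gt0.
transitivity (k0^-1 *: \sum_(d <- D) k0 *:
    \sum_(p <- L | (p.1.2 == 0%N) && (`|p.1.1 - d.1| < d.2%:C)) p.2).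
  congr (_ *: _); rewrite !big_seq; apply: eq_bigr => d dD.
  rewrite -(@circle_integral_sum _ _ d.1 d.2 _ L (fun p => p.1.1)
    (fun p => p.1.2) (fun p => p.2)).
  - rewrite /circle_integral; congr vector_integral; apply/funext => t.
    rewrite Lr// => st; have := off _ _ st dD; rewrite /circle_point addrC addKr.
    rewrite normrM -/(cis t) normr_cis mulr1 ger0_norm ?eqxx//.
    by rewrite ler0c ltW ?D0.
  - exact: D0.
  - by move=> p /Ls sp_; exact: off.
rewrite -scaler_sumr scalerA mulVf// scale1r.
rewrite (eq_bigr _ (fun d _ => big_mkcond _ _)) exchange_big /= [RHS]big_mkcond.
rewrite !big_seq; apply: eq_bigr => p /Ls spec.
case: (p.1.2 == 0%N) => /=; last by rewrite big1.
case: asboolP => [Op|nOp]; last first.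
  rewrite big_seq big1// => d dD; case: ifP => // pd.
  by have [] := inside _ _ spec dD (ltW pd).
have [d dD pd] := Din _ spec Op.
rewrite (bigD1_seq d)//= pd big1_seq ?addr0// => e /andP[ed eD].
case: ifP => // pe; have := Ddisj _ _ eD dD ed p.1.1.
by case; split; exact: ltW.
Qed.

End CauchyDiscs.

Section RieszDimension.
Context (R : realType) (H : vectType R[i]) (T : 'End(H)).
Local Notation C := R[i].
Local Notation n := (dim H).
Context (P : 'M[C]_n).
Hypothesis Pu : P \in unitmx.
Local Notation U := (opmx P T).
Hypothesis tU : is_trig_mx U.

Lemma opmx_sub_scalar a : opmx P (sub_scalar T a) = U - a%:M.
Proof. by rewrite (opmxB Pu) (opmxZ Pu) (opmx1 Pu) scalemx1. Qed.

Lemma opmx_shift_op s X : opmx P (shift_op T s X) = opmx P X *m shift_prod U s.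
Proof.
elim: s => [|a s IH] /=; first by rewrite mulmx1.
by rewrite (opmx_comp Pu) IH opmx_sub_scalar mulmxA.
Qed.

Lemma spectrum_trig z : spectrum T z <-> z \in [seq U i i | i <- enum 'I_n].
Proof.
have unitE : (U - z%:M \in unitmx) = (z \notin [seq U i i | i <- enum 'I_n]).
  have [tV dE] := shift_prod_trig [:: z] tU.
  rewrite -[U - _]mul1mx -[_ *m _]/(shift_prod U [:: z]).
  rewrite unitmxE det_trig// unitfE; apply/idP/idP.
    apply: contraL => /mapP[i _ zE]; apply/negP => /prodf_neq0/(_ i isT).
    by rewrite dE big_seq1 zE subrr eqxx.
  move=> zU; apply/prodf_neq0 => i _; rewrite dE big_seq1 subr_eq0.
  by apply: contraNneq zU => <-; apply/mapP; exists i; rewrite ?mem_enum.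
split=> [sz|zU].
  apply/negPn/negP; rewrite -unitE => Uu; apply: sz.
  exists (mxop P (invmx (U - z%:M))); split; apply: (opmx_inj Pu).
    by rewrite (opmx_comp Pu) (mxopK Pu) opmx_sub_scalar (opmx1 Pu) mulmxV.
  by rewrite (opmx_comp Pu) (mxopK Pu) opmx_sub_scalar (opmx1 Pu) mulVmx.
move=> [S [ST TS]]; move: zU; apply/negP; rewrite -unitE -opmx_sub_scalar.
have E1 : opmx P (sub_scalar T z) *m opmx P S = 1%:M.
  by rewrite -(opmx_comp Pu) ST (opmx1 Pu).
by have [uT _] := mulmx1_unit E1; exact: uT.
Qed.

(** The image of [X] lies in the kernel of a product of [T - a] with [a] in [s],
    whose rank is at least the number of eigenvalues outside [s]. *)
Lemma killed_rank_le (Q : C -> bool) s X : (forall a, a \in s -> Q a) ->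
  shift_op T s X = 0 -> (\rank (opmx P X) <= #|[pred i | Q (U i i)]|)%N.
Proof.
move=> sQ /(congr1 (opmx P)); rewrite opmx_shift_op.
rewrite (_ : opmx P 0 = 0); last by rewrite -(scale0r 0) (opmxZ Pu) scale0r.
move=> /mulmx0_rank_max rX.
have le1 : (#|[pred i | U i i \in s]| <= #|[pred i | Q (U i i)]|)%N.
  by apply: subset_leq_card; apply/fintype.subsetP => i; rewrite !inE; exact: sQ.
apply: leq_trans le1.
rewrite -(leq_add2r #|[predC [pred i | U i i \in s]]|) cardC card_ord.
by apply: leq_trans rX; rewrite leq_add2l; exact: shift_prod_rank.
Qed.

Lemma killed_sum (Q : C -> bool) (L : seq (C * nat * 'End(H))) (k : pred nat) :
  (forall p, p \in L -> exists m, shift_op T (nseq m p.1.1) p.2 = 0) ->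
  exists2 s, forall a, a \in s -> Q a &
    shift_op T s (\sum_(p <- L | k p.1.2 && Q p.1.1) p.2) = 0.
Proof.
move=> LT; rewrite big_seq_cond.
apply: (big_ind (fun X => exists2 s, forall a, a \in s -> Q a & shift_op T s X = 0)).
- by exists [::].
- move=> X Y [s sQ sX] [t tQ tY]; exists (s ++ t).
    by move=> a; rewrite mem_cat => /orP[/sQ|/tQ].
  by rewrite shift_opD !shift_op_cat tY shift_op0 shift_opC sX shift_op0 addr0.
- move=> p /andP[/LT[m pm] /andP[_ Qp]]; exists (nseq m p.1.1) => //.
  by move=> a /nseqP[-> _].
Qed.

(** The Riesz idempotent and its complement are both annihilated by products of
    [T - a] over eigenvalues [a] of their own part of the spectrum. This bounds
    their ranks by numbers that add up to the dimension. *)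
Lemma dim_riesz_space Omega :
  \dim (riesz_space Omega T) = #|[pred i | `[< Omega (U i i) >]]|.
Proof.
have op0 : opmx P (0 : 'End(H)) = 0.
  by rewrite -(scale0r (0 : 'End(H))) (opmxZ Pu) scale0r.
have CH : shift_op T [seq U i i | i <- enum 'I_n] \1%VF = 0.
  by apply: (opmx_inj Pu); rewrite opmx_shift_op shift_prod_diag// mulmx0 op0.
have [L [Ls Lr L1]] := resolvent_expansion (gen_span_shift CH).
have RE := @riesz_idempotent_expansion _ _ T _ spectrum_trig Omega L
  (fun p pL => (Ls p pL).1) _.
rewrite /riesz_space (dim_limg Pu) {}RE; last first.
  by move=> z /Lr; rewrite comp_lfun1r.
pose Q a := `[< Omega a >].
pose E := \sum_(p <- L | (p.1.2 == 0%N) && Q p.1.1) p.2.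
pose F := \sum_(p <- L | (p.1.2 == 0%N) && ~~ Q p.1.1) p.2.
have LT p : p \in L -> exists m, shift_op T (nseq m p.1.1) p.2 = 0 by case/Ls.
have [s sQ sE] := killed_sum Q (fun k => k == 0%N) LT.
have [t tQ tF] := killed_sum (fun a => ~~ Q a) (fun k => k == 0%N) LT.
have rE := killed_rank_le sQ sE.
have rF := killed_rank_le tQ tF.
rewrite -/E in rE *; rewrite -/F in rF.
have EF : E + F = \1%VF by rewrite L1 [RHS](bigID (fun p => Q p.1.1)).
apply/eqP; rewrite eqn_leq rE /=.
rewrite -(leq_add2r #|[predC [pred i | Q (U i i)]]|) cardC card_ord.
have := mxrank_add (opmx P E) (opmx P F).
rewrite -(opmxD Pu) EF (opmx1 Pu) mxrank1 => /leq_trans; apply.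
by rewrite leq_add2l.
Qed.

End RieszDimension.

(** * Balanced operators *)

Section OpenDiscs.
Context (K : numFieldType).
Implicit Types c r : K.

Let dist_triangle c (x y : K) : `|y - c| <= `|x - c| + `|x - y|.
Proof.
rewrite [`|x - y|]distrC [leRHS]addrC (_ : y - c = (y - x) + (x - c)) ?ler_normD//.
by ring.
Qed.

Lemma open_disc c r : open [set z : K | `|z - c| < r].
Proof.
rewrite openE => z /= zr; apply/nbhs_ballP; exists (r - `|z - c|).
  by rewrite /= subr_gt0.
move=> y; rewrite -ball_normE /= ltrBrDl; apply: le_lt_trans.
exact: dist_triangle.
Qed.

Lemma open_disc_exterior c r : open [set z : K | r < `|z - c|].
Proof.
rewrite openE => z /= zr; apply/nbhs_ballP; exists (`|z - c| - r).
  by rewrite /= subr_gt0.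
move=> y; rewrite -ball_normE /= ltrBrDl -ltrBrDr => /lt_le_trans; apply.
by rewrite lerBlDr [`|z - y|]distrC; exact: dist_triangle.
Qed.

End OpenDiscs.

Section Main.
Context (R : realType) (H : vectType R[i]) (dot : {dot H for Num.conj}).
Local Notation C := R[i].
Local Notation n := (dim H).
Implicit Types (T S : 'End(H)) (P : 'M[C]_n).

Lemma trig_coords T : exists2 P : 'M[C]_n, P \in unitmx & is_trig_mx (opmx P T).
Proof.
have [n0|n_gt0] := posnP n.
  exists 1%:M; rewrite ?unitmx1//; apply/is_trig_mxP => i.
  by have := ltn_ord i; rewrite [X in (_ < X)%N]n0.
have [Q /unitarymx_unit Qu tQ] := Schur (f2mx T) n_gt0.
exists (invmx Q); first by rewrite unitmx_inv.
by rewrite /opmx invmxK -conjumx//; exact: tQ.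
Qed.

Lemma det_opmx P T z : P \in unitmx ->
  \det (z%:M - opmx P T) = \det (z%:M - f2mx T).
Proof.
move=> Pu; rewrite /opmx.
rewrite (_ : z%:M - _ = invmx P *m (z%:M - f2mx T) *m P).
  by rewrite !det_mulmx mulrAC -det_mulmx mulVmx// det1 mul1r.
by rewrite mulmxBr mulmxBl scalar_mxC -(mulmxA z%:M) mulVmx// mulmx1.
Qed.

Lemma opmx_idempotent_commutator P T : P \in unitmx ->
  idempotent_commutators T <-> mx_idempotent_commutator (opmx P T).
Proof.
move=> Pu; split.
  move=> [E EE [F FF <-]]; exists (opmx P F), (opmx P E).
  rewrite (opmxB Pu) !(opmx_comp Pu); split=> //.
    by rewrite -(opmx_comp Pu) FF.
  by rewrite -(opmx_comp Pu) EE.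
move=> [E [F [EE FF TE]]].
have [E' E'E] := opmx_surj Pu E; have [F' F'F] := opmx_surj Pu F.
exists F'; first by apply: (opmx_inj Pu); rewrite (opmx_comp Pu) F'F.
exists E'; first by apply: (opmx_inj Pu); rewrite (opmx_comp Pu) E'E.
by apply: (opmx_inj Pu); rewrite (opmxB Pu) !(opmx_comp Pu) E'E F'F.
Qed.

Lemma norm_closure_paired T P : P \in unitmx -> is_trig_mx (opmx P T) ->
  norm_closure dot (@idempotent_commutators R H) T <->
  exists p, paired (fun i => opmx P T i i) p.
Proof.
move=> Pu tU; split.
  move=> Tcl; apply: trig_det_symmetric_paired => // z.
  have [P0 P0u dotP] := orthonormal_coords dot.
  rewrite !(det_opmx T _ Pu) -!(det_opmx T _ P0u).
  apply: det_symmetric_limit => e e0.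
  have eE : (complex.Re e)%:C = e by rewrite RRe_real// gtr0_real.
  have [|S Scom TS] := Tcl (complex.Re e); first by rewrite -ltcR eE.
  exists (opmx P0 S).
    by apply: idempotent_commutator_det; apply/opmx_idempotent_commutator.
  move=> i j; have := opmx_le_opnorm P0u dotP (T - S) i j.
  rewrite (opmxB P0u) [X in `|X|]mxE [X in `|_ + X|]mxE => /le_lt_trans; apply.
  by rewrite -eE ltcR.
move=> [p pP] e e0.
have [W WP] := paired_perturbation tU pP.
have [P0 P0u dotP] := orthonormal_coords dot.
have [W' W'W] := opmx_surj Pu W.
have [M M0 WM] := opnorm_scale_le P0u dotP (- W').
have M1 : 0 < M + 1 by rewrite ltr_wpDl.
have [t [t0 te tW]] := WP (e / (M + 1)) (divr_gt0 e0 M1).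
exists (T + t%:C *: W').
  by apply/(opmx_idempotent_commutator _ Pu); rewrite (opmxD Pu) (opmxZ Pu) W'W.
rewrite opprD addrA subrr add0r -scalerN.
apply: le_lt_trans (WM t (ltW t0)) _.
move: te; rewrite ltr_pdivlMr//; apply: le_lt_trans.
by rewrite ler_wpM2l ?lerDl// ltW.
Qed.

Lemma semi_fredholm_lfun T : semi_fredholm dot T.
Proof.
have [P Pu dotP] := orthonormal_coords dot.
split; first exact: (closed_range_lfun Pu dotP).
by rewrite /Order.min; case: ifP => _; exact: ltry.
Qed.

Lemma fredholm_index_lfun T : fredholm_index dot T = 0.
Proof.
have [P Pu dotP] := orthonormal_coords dot.
apply/eqP; rewrite subr_eq0 eqz_nat; apply/eqP/esym.
exact: dim_lker_adjoint Pu dotP T.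
Qed.

(** For a small disc around [c], the equality of the dimensions of the Riesz spaces
    says that [c] and [- c] have the same multiplicity. *)
Lemma balanced_paired T P : P \in unitmx -> is_trig_mx (opmx P T) ->
  balanced dot T <-> exists p, paired (fun i => opmx P T i i) p.
Proof.
move=> Pu tU; pose a i := opmx P T i i; split.
  move=> [_ dimT _]; apply: negation_pairing => c.
  have [r r0 gap] := spectral_gap ([:: c; - c] ++ [seq a i | i <- enum 'I_n]).
  have {}gap i x : x \in [:: c; - c] -> a i != x -> r%:C < `|a i - x|.
    move=> xc; apply: gap; rewrite mem_cat; last by rewrite xc.
    by apply/orP; right; apply/mapP; exists i; rewrite ?mem_enum.
  have rC0 : 0 < r%:C by rewrite -(rmorph0 (real_complex R)) ltcR.
  have near i x : x \in [:: c; - c] -> (`|a i - x| < r%:C) = (a i == x).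
    move=> xc; have [->|ax] := eqVneq (a i) x; first by rewrite subrr normr0.
    apply/negbTE; rewrite -real_leNgt ?normr_real ?gtr0_real//; apply: ltW.
    exact: gap.
  have := dimT [set z | `|z - c| < r%:C] [set z | r%:C < `|z - c|]
    (@open_disc _ _ _) (@open_disc_exterior _ _ _) _ _.
  rewrite !(dim_riesz_space Pu tU) => E.
  have -> : #|[pred i | a i == c]| =
      #|[pred i | `[< [set z : C | `|z - c| < r%:C] (opmx P T i i) >]]|.
    apply: eq_card => i; rewrite !inE -near ?mem_head//.
    by apply/idP/asboolP.
  rewrite E.
  - apply: eq_card => i; rewrite !inE -near ?inE ?eqxx ?orbT// opprK.
    apply/asboolP/idP => [[z /= zc zE]|ac].
      by rewrite (_ : a i = - z) // -normrN opprD opprK.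
    by exists (- a i); [rewrite /= -normrN opprD !opprK|rewrite opprK].
  - by apply/seteqP; split => // z /= [/lt_trans/[apply]]; rewrite ltxx.
  - move=> z /(spectrum_trig Pu tU)/mapP[i _ ->].
    have [aic|ac] := eqVneq (a i) c.
      by left; rewrite /= -/(a i) aic subrr normr0.
    by right; apply: gap; first exact: mem_head.
move=> [p [pp ap _]]; split.
- have tN : is_trig_mx (opmx P (- T)).
    rewrite (opmxN Pu); apply/is_trig_mxP => i j ij.
    by rewrite mxE (is_trig_mxP tU)// oppr0.
  apply/seteqP; split=> z.
    move/(spectrum_trig Pu tU)/mapP => [i _ ->]; apply/(spectrum_trig Pu tN)/mapP.
    by exists (p i); [rewrite mem_enum|rewrite (opmxN Pu) [RHS]mxE ap opprK].
  move/(spectrum_trig Pu tN)/mapP => [i _ ->]; apply/(spectrum_trig Pu tU)/mapP.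
  by exists (p i); [rewrite mem_enum|rewrite (opmxN Pu) [LHS]mxE ap].
- move=> Omega1 _ _ _ _ _; rewrite !(dim_riesz_space Pu tU).
  rewrite -!sum1_card (reindex_inj (inv_inj pp)); apply: eq_bigl => i.
  rewrite !inE; apply/asboolP/asboolP => [inOmega|].
    by exists (opmx P T (p i) (p i)); [exact: inOmega|rewrite ap opprK].
  by case=> z inOmega zE; rewrite ap -zE opprK.
- move=> b; split; first by split => _; exact: semi_fredholm_lfun.
  by move=> _; rewrite !fredholm_index_lfun.
Qed.

End Main.

Unset Implicit Arguments.
Set Strict Implicit.

Theorem theorem3p5 (R : realType) (H : vectType R[i])
    (dot : {dot H for Num.conj}) :
  norm_closure dot (@idempotent_commutators R H) = [set T | balanced dot T].
Proof.
apply/seteqP; split=> T /=; have [P Pu tU] := trig_coords T.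
  by move/(norm_closure_paired dot Pu tU)/(balanced_paired dot Pu tU).
by move/(balanced_paired dot Pu tU)/(norm_closure_paired dot Pu tU).
Qed.
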